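(* Let $X$ be a computable Polish space, $\nu$ a computable Borel probability measure on $X$, and $(\mathscr F_n)$ an almost-full effective filtration equipped uniformly with Kurtz disintegrations $\rho^{(n)}$. Let $p>1$ be a computable real. Then for $x\in X$ the following are equivalent: (1) $x\in\mathsf{DR}^\nu_\rho(X)$; (2) $x\in\mathsf{KR}^\nu$ and $\lim_n\mathbb E_\nu[f\mid\mathscr F_n](x)=f(x)$ for all $L_p(\nu)$ Martin-Löf tests $f$; (3) $x\in\mathsf{KR}^\nu$, $\lim_n\mathbb E_\nu[f\mid\mathscr F_n](x)$ exists for all $L_p(\nu)$ Martin-Löf tests $f$, and $\lim_n\mathbb E_\nu[I_U\mid\mathscr F_n](x)=I_U(x)$ for every c.e. open $U$. Here ''$\lim_n a_n=b$'' means the limit exists, is finite and equals $b$; ''exists'' means exists and is finite.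
   Context: A computable Polish space is a Polish space $X$ with a distinguished dense sequence $x_0,x_1,\dots$ and a compatible complete metric $d$ with $d(x_i,x_j)$ uniformly computable. An open set is c.e. open if it equals $\bigcup_i B(x_{n(i)},r_i)$ for computable $n(\cdot)$ and a computable sequence of positive rationals $r_i$. A function $f:X\to(-\infty,\infty]$ is lower semi-computable (lsc) if the sets $f^{-1}(q,\infty]$, $q\in\mathbb Q$, are uniformly c.e. open. A Borel probability measure $\nu$ is computable if $\nu(U)$ is left-c.e. uniformly in the c.e. open $U$. For computable $p\ge1$, an $L_p(\nu)$ Martin-Löf test is an lsc $f:X\to[0,\infty]$ with $\|f\|_p<\infty$. $\mathsf{KR}^\nu$ is the set of points in every c.e. open set of $\nu$-measure 1; $\mathsf{MLR}^\nu$ the set of $x$ with $f(x)<\infty$ for every $L_1(\nu)$ Martin-Löf test $f$. A $\nu$-computable basis is a computable sequence of c.e. open sets such that every c.e. open set is effectively a union of its members, finite unions of members have uniformly computable $\nu$-measure, and each member is uniformly paired with an effectively closed superset of equal $\nu$-measure. An almost-full effective filtration is an increasing sequence $(\mathscr F_n)$ of $\sigma$-algebras, $\mathscr F_n$ generated by a sequence $\{A_{n,m}\}_m$, uniformly computable in $n,m$, of members of the algebra generated by a $\nu$-computable basis, with a uniform procedure computing from a c.e. open $U$ a sequence $A_{n_i,m_i}$ with $U\cap\mathsf{KR}^\nu=\bigcup_iA_{n_i,m_i}\cap\mathsf{KR}^\nu$. For countably generated $\mathscr F$, $[x]_{\mathscr F}$ is the set of points in exactly the same members of $\mathscr F$ as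 $x$. A Borel measurable $\rho:X\to\mathcal M^+(X)$ (finite nonnegative Borel measures) is a Kurtz disintegration of $\mathscr F$ with respect to $\nu$ if: (a) for every Borel $f$ with $\int|f|d\nu<\infty$, $x\mapsto\int f\,d\rho_x$ is a version of the conditional expectation of $f$ given $\mathscr F$; (b) for $x\in\mathsf{KR}^\nu$, $\rho_x(X)=1$ and $\rho_x([x]_{\mathscr F}\cap\mathsf{KR}^\nu)=1$; (c) $x\mapsto\rho_x(U)$ is lsc uniformly in c.e. open $U$. The filtration is equipped uniformly with such $\rho^{(n)}$ for $\mathscr F_n$, and $\mathbb E_\nu[f\mid\mathscr F_n](x)=\int f\,d\rho^{(n)}_x$. $\mathsf{DR}^\nu_\rho(X)$ (density random points) is the set of $x\in\mathsf{MLR}^\nu$ such that $\lim_n\rho^{(n)}_x(U)=\delta_x(U)$ for every c.e. open $U$, where $\delta_x$ is the Dirac measure at $x$. *)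

(* Defs.v *)
From Stdlib Require Cantor.
From HB Require Import structures.
From mathcomp Require Import all_boot all_order all_algebra.
From mathcomp Require Import all_classical all_reals all_analysis.
From mathcomp Require Import measurable_realfun.

Set Implicit Arguments.
Unset Strict Implicit.
Unset Printing Implicit Defensive.

Import Order.TTheory GRing.Theory Num.Theory.
Import numFieldNormedType.Exports.

Local Open Scope classical_set_scope.
Local Open Scope ring_scope.

Definition npair (a b : nat) : nat := Cantor.to_nat (a, b).
Definition nfst (n : nat) : nat := (Cantor.of_nat n).1.
Definition nsnd (n : nat) : nat := (Cantor.of_nat n).2.

(** Programs for the unary partial recursive functions; several arguments are
    passed through [npair]. *)
Inductive code : Type :=
| Zero
| Succ
| Fst
| Snd
| Pair of code & code
| Comp of code & code
| Prec of code & code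
| Mini of code.

(** [evals c n m]: the program [c] halts on input [n] with output [m].
    [Prec f g] maps <a, 0> to f(a) and <a, k+1> to g<a, <k, r>>, where r is its
    value at <a, k>; [Mini f] maps a to the least m with f<a, m> = 0, all
    previous values of f being defined. *)
Fixpoint evals (c : code) : nat -> nat -> Prop :=
  match c with
  | Zero => fun _ m => m = 0%N
  | Succ => fun n m => m = n.+1
  | Fst => fun n m => m = nfst n
  | Snd => fun n m => m = nsnd n
  | Pair f g => fun n m =>
      exists a b, [/\ evals f n a, evals g n b & m = npair a b]
  | Comp f g => fun n m => exists2 a, evals g n a & evals f a m
  | Prec f g => fun n =>
      (fix loop k m := match k with
       | 0%N => evals f (nfst n) m
       | k'.+1 => exists2 r, loop k' r &
                    evals g (npair (nfst n) (npair k' r)) m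
       end) (nsnd n)
  | Mini f => fun n m =>
      evals f (npair n m) 0%N /\
      forall i, (i < m)%N -> exists r, evals f (npair n i) r.+1
  end.

Fixpoint code_num (c : code) : nat :=
  match c with
  | Zero => npair 0 0
  | Succ => npair 1 0
  | Fst => npair 2 0
  | Snd => npair 3 0
  | Pair f g => npair 4 (npair (code_num f) (code_num g))
  | Comp f g => npair 5 (npair (code_num f) (code_num g))
  | Prec f g => npair 6 (npair (code_num f) (code_num g))
  | Mini f => npair 7 (code_num f)
  end.

Definition computable (h : nat -> nat) : Prop :=
  exists c, forall n, evals c n (h n).

Definition halting (c : code) : set nat := [set n | exists m, evals c n m].

Definition ce (A : set nat) : Prop := exists c, A = halting c.

(** The c.e. set of index [e]; it is empty when [e] is not the number of a
    program. *)
Definition ce_set (e : nat) : set nat :=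
  [set n | exists2 c, code_num c = e & halting c n].

Definition slice (A : set nat) (i : nat) : set nat := [set k | A (npair i k)].

Definition rat_num (k : nat) : rat :=
  ((nfst (nfst k))%:Q - (nsnd (nfst k))%:Q) / (nsnd k).+1%:Q.
Definition posrat_num (k : nat) : rat := (nfst k).+1%:Q / (nsnd k).+1%:Q.

Definition computable_real {R : realType} (a : R) : Prop :=
  exists2 h, computable h &
    forall k, `|a - ratr (rat_num (h k))| <= 2%:R ^- k.

Definition unif_computable_real {R : realType} (a : nat -> R) : Prop :=
  exists2 h, computable h &
    forall i k, `|a i - ratr (rat_num (h (npair i k)))| <= 2%:R ^- k.

Inductive alg_term : Type :=
| Gen of nat
| Compl of alg_term
| Union of alg_term & alg_term.

Fixpoint alg_num (t : alg_term) : nat :=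
  match t with
  | Gen i => npair 0 i
  | Compl t1 => npair 1 (alg_num t1)
  | Union t1 t2 => npair 2 (npair (alg_num t1) (alg_num t2))
  end.

Fixpoint alg_set {X : Type} (V : nat -> set X) (t : alg_term) : set X :=
  match t with
  | Gen i => V i
  | Compl t1 => ~` alg_set V t1
  | Union t1 t2 => alg_set V t1 `|` alg_set V t2
  end.

#[short(type="completeMetricType")]
HB.structure Definition CompleteMetric (R : realType) :=
  { X of Metric R X & Complete X & Pointed X }.

Definition computable_polish {R : realType} {X : completeMetricType R}
    (s : nat -> X) : Prop :=
  dense (range s) /\
  unif_computable_real (fun k => mdist (s (nfst k)) (s (nsnd k)) : R).

Definition borel {R : realType} (X : completeMetricType R) :
    measurableType (@open X).-sigma :=
  g_sigma_algebraType (@open X).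

Section randomness.
Context {R : realType} {X : completeMetricType R}.
Variable s : nat -> X.

Definition basic_ball (k : nat) : set X :=
  ball (s (nfst k)) (ratr (posrat_num (nsnd k)) : R).

Definition open_of (A : set nat) : set X := \bigcup_(k in A) basic_ball k.

(** The c.e. open set of index [e]. A nonempty c.e. set being the range of a
    total computable function, these are the unions of computable sequences of
    basic balls, together with the empty set. *)
Definition ce_open (e : nat) : set X := open_of (ce_set e).

Definition unif_ce_open (U : nat -> set X) : Prop :=
  exists2 A, ce A & forall i, U i = open_of (slice A i).

Definition lower_semicomputable (f : X -> \bar R) : Prop :=
  (forall x, -oo < f x)%E /\
  unif_ce_open (fun q => [set x | (ratr (rat_num q))%:E < f x]%E).

Definition unif_lower_semicomputable (f : nat -> X -> \bar R) : Prop :=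
  (forall i x, -oo < f i x)%E /\
  unif_ce_open
    (fun k => [set x | (ratr (rat_num (nsnd k)))%:E < f (nfst k) x]%E).

Variable nu : probability (borel X) R.

(** [nu (ce_open e)] is left-c.e. uniformly in [e]. *)
Definition computable_measure : Prop :=
  ce [set k | (ratr (rat_num (nsnd k)))%:E < nu (ce_open (nfst k))]%E.

Definition ML_test (p : R) (f : X -> \bar R) : Prop :=
  [/\ lower_semicomputable f,
      (forall x, 0 <= f x)%E &
      (Lnorm nu p%:E (f : borel X -> \bar R) < +oo)%E].

Definition KR : set X :=
  [set x | forall e, nu (ce_open e) = 1%E -> ce_open e x].

Definition MLR : set X := [set x | forall f, ML_test 1 f -> (f x < +oo)%E].

Definition computable_basis (V : nat -> set X) : Prop :=
  [/\ unif_ce_open V,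
      exists2 A, ce A & forall e, ce_open e = \bigcup_(i in slice A e) V i,
      unif_computable_real (fun l =>
        fine (nu (\bigcup_(i in [set i | i \in CodeSeq.decode l]) V i))) &
      exists2 W, unif_ce_open W &
        forall i, V i `<=` ~` W i /\ nu (~` W i) = nu (V i)].

Definition unif_computable_in_algebra (V : nat -> set X)
    (A : nat -> nat -> set X) : Prop :=
  exists2 t : nat -> nat -> alg_term,
    computable (fun k => alg_num (t (nfst k) (nsnd k))) &
    forall n m, A n m = alg_set V (t n m).

Definition almost_full_filtration (F : nat -> set (set X)) : Prop :=
  (forall n, F n `<=` F n.+1) /\
  exists A : nat -> nat -> set X,
  [/\ forall n, F n = <<s range (A n) >>,
      exists2 V, computable_basis V & unif_computable_in_algebra V A &
      exists2 S, ce S & forall e,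
        ce_open e `&` KR =
        (\bigcup_(k in slice S e) A (nfst k) (nsnd k)) `&` KR].

Definition atom (F : set (set X)) (x : X) : set X :=
  [set y | forall A, F A -> (A x <-> A y)].

Definition cond_exp_version (F : set (set X)) (f g : X -> \bar R) : Prop :=
  [/\ measurable_fun setT (g : g_sigma_algebraType F -> \bar R),
      nu.-integrable [set: borel X] g &
      forall A, F A ->
        (\int[nu]_(y in (A : set (borel X))) g y =
         \int[nu]_(y in (A : set (borel X))) f y)%E].

Definition cond_exp (rho : R.-ftker (borel X) ~> (borel X))
    (f : X -> \bar R) (x : X) : \bar R :=
  (\int[rho x]_y f y)%E.

(** Kurtz disintegrations [rho n] of [F n], uniformly in [n]. A Borel map into
    the finite Borel measures is a finite transition kernel. *)
Definition kurtz_disintegrations (F : nat -> set (set X))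
    (rho : nat -> R.-ftker (borel X) ~> (borel X)) : Prop :=
  [/\ forall n f, nu.-integrable [set: borel X] f ->
        cond_exp_version (F n) f (cond_exp (rho n) f),
      forall n x, KR x ->
        rho n x setT = 1%E /\ rho n x (atom (F n) x `&` KR) = 1%E &
      unif_lower_semicomputable
        (fun k x => rho (nfst k) x (ce_open (nsnd k)))].

Definition DR (rho : nat -> R.-ftker (borel X) ~> (borel X)) : set X :=
  [set x | MLR x /\ forall e,
     rho n x (ce_open e) @[n --> \oo] --> \d_(x : borel X) (ce_open e)].

End randomness.

(* Main.v *)
Require Import Defs.
From Stdlib Require Cantor.
From mathcomp Require Import all_boot all_order all_algebra.
From mathcomp Require Import all_classical all_reals all_analysis.
From mathcomp Require Import measurable_realfun ring lra.
Import Order.TTheory GRing.Theory Num.Theory.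
Import numFieldNormedType.Exports.

Set Implicit Arguments.
Unset Strict Implicit.
Unset Printing Implicit Defensive.

Local Open Scope classical_set_scope.
Local Open Scope ring_scope.

(** A uniformly c.e. sequence of open sets [G k] with [nu (G k) = O(4 ^- k)]
    yields the L_1 test [y |-> sup {k + 1 | G k y}], which is even an L_p test
    when [nu (G k) = O(4 ^- (P k))] for some [P >= p].

    From (1) to (2), choose [b] with [p >= 1 + 2 / b] and let
    [V i = {f > 2 ^ (b i)}].  By Markov's inequality
    [nu (V i) = O(2 ^- ((b + 2) i))], and Doob's maximal inequality for the
    martingales [rho n y (V i)] shows that the c.e. open sets
    [G k = U_(n, i) {y | rho n y (V i) > 4 ^ k 2 ^- ((b + 1) i)}] form a
    Martin-Löf test.  A Martin-Löf random [x] leaves some [G k], which bounds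
    [rho n x (V i)] uniformly in [n] by a sequence so small that [f] is uniformly
    integrable for the measures [rho n x]; convergence of these measures on c.e.
    open sets then upgrades to convergence of the integrals of [f].

    From (3) to (1), if an L_1 test were infinite at [x], its superlevel sets
    would yield as above an L_p test infinite at [x].  The superlevel sets of the
    latter are c.e. open and contain [x], so that its conditional expectations
    at [x] would exceed every bound. *)

(** * Computable functions and c.e. sets *)

Section computable_functions.
Local Open Scope nat_scope.

Lemma nfst_pair a b : nfst (npair a b) = a.
Proof. by rewrite /nfst /npair Cantor.cancel_of_to. Qed.

Lemma nsnd_pair a b : nsnd (npair a b) = b.
Proof. by rewrite /nsnd /npair Cantor.cancel_of_to. Qed.

Lemma npair_fst_snd n : npair (nfst n) (nsnd n) = n.
Proof.
by rewrite /nfst /nsnd /npair -surjective_pairing Cantor.cancel_to_of.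
Qed.

Lemma npair_inj a b c d : npair a b = npair c d -> a = c /\ b = d.
Proof.
move=> e; split; first by rewrite -(nfst_pair a b) e nfst_pair.
by rewrite -(nsnd_pair a b) e nsnd_pair.
Qed.

Definition npairE := (nfst_pair, nsnd_pair).

Lemma eq_computable f g : f =1 g -> computable f -> computable g.
Proof. by move=> /funext ->. Qed.

Lemma computable_comp f g :
  computable f -> computable g -> computable (fun n => f (g n)).
Proof.
by move=> [c hc] [d hd]; exists (Comp c d) => n /=; exists (g n).
Qed.

Lemma computable_pair f g :
  computable f -> computable g -> computable (fun n => npair (f n) (g n)).
Proof.
by move=> [c hc] [d hd]; exists (Pair c d) => n /=; exists (f n), (g n).
Qed.

Lemma computable_id : computable (fun n => n).
Proof.
exists (Pair Fst Snd) => n /=; exists (nfst n), (nsnd n).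
by rewrite npair_fst_snd.
Qed.

Lemma computable_fst f : computable f -> computable (fun n => nfst (f n)).
Proof. by apply: computable_comp; exists Fst. Qed.

Lemma computable_snd f : computable f -> computable (fun n => nsnd (f n)).
Proof. by apply: computable_comp; exists Snd. Qed.

Lemma computable_succ f : computable f -> computable (fun n => (f n).+1).
Proof. by apply: computable_comp; exists Succ. Qed.

Fixpoint const_code k := if k is k'.+1 then Comp Succ (const_code k') else Zero.

Lemma evals_const_code k n m : evals (const_code k) n m <-> m = k.
Proof.
elim: k m => [//|k IH] m /=; split; first by case=> a /IH -> ->.
by move=> ->; exists k => //; apply/IH.
Qed.

Lemma computable_const k : computable (fun=> k).
Proof. by exists (const_code k) => n; apply/evals_const_code. Qed.

Lemma computable_rec (f h : nat -> nat) (g : nat -> nat -> nat -> nat) :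
  computable f ->
  computable (fun k => g (nfst k) (nfst (nsnd k)) (nsnd (nsnd k))) ->
  computable h ->
  computable (fun n => nat_rect (fun=> nat) (f n) (g n) (h n)).
Proof.
move=> [cf cfP] [cg cgP] [ch chP].
exists (Comp (Prec cf cg) (Pair (Pair Fst Snd) ch)) => n /=.
exists (npair n (h n)).
  exists n, (h n); split=> //.
  by exists (nfst n), (nsnd n); rewrite npair_fst_snd.
rewrite !npairE; elim: (h n) => [|k IH] //=.
eexists; first exact: IH.
have := cgP (npair n (npair k (nat_rect (fun=> nat) (f n) (g n) k))).
by rewrite !npairE.
Qed.

Lemma computable_add f g :
  computable f -> computable g -> computable (fun n => f n + g n).
Proof.
move=> cf cg; pose step (n k r : nat) := r.+1.
apply: (@eq_computable (fun n => nat_rect (fun=> nat) (f n) (step n) (g n))).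
  by move=> n; elim: (g n) => [|k /= ->]; rewrite ?addn0 ?addnS.
apply: computable_rec => //.
exact/computable_succ/computable_snd/computable_snd/computable_id.
Qed.

Lemma computable_mul f g :
  computable f -> computable g -> computable (fun n => f n * g n).
Proof.
move=> cf cg; pose step (n k r : nat) := f n + r.
apply: (@eq_computable (fun n => nat_rect (fun=> nat) 0 (step n) (g n))).
  by move=> n; elim: (g n) => [|k /= ->]; rewrite ?muln0 ?mulnS.
apply: computable_rec => //; first exact: computable_const.
apply: computable_add.
  exact: computable_comp (computable_fst computable_id).
exact/computable_snd/computable_snd/computable_id.
Qed.

Lemma computable_pred f : computable f -> computable (fun n => (f n).-1).
Proof.
move=> cf; pose step (n k r : nat) := k.
apply: (@eq_computable (fun n => nat_rect (fun=> nat) 0 (step n) (f n))).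
  by move=> n; case: (f n).
apply: computable_rec => //; first exact: computable_const.
exact/computable_fst/computable_snd/computable_id.
Qed.

Lemma computable_sub f g :
  computable f -> computable g -> computable (fun n => f n - g n).
Proof.
move=> cf cg; pose step (n k r : nat) := r.-1.
apply: (@eq_computable (fun n => nat_rect (fun=> nat) (f n) (step n) (g n))).
  by move=> n; elim: (g n) => [|k /= ->]; rewrite ?subn0 ?subnS.
apply: computable_rec => //.
exact/computable_pred/computable_snd/computable_snd/computable_id.
Qed.

Lemma computable_exp f g :
  computable f -> computable g -> computable (fun n => f n ^ g n).
Proof.
move=> cf cg; pose step (n k r : nat) := f n * r.
apply: (@eq_computable (fun n => nat_rect (fun=> nat) 1 (step n) (g n))).
  by move=> n; elim: (g n) => [|k /= ->]; rewrite ?expn0 ?expnS.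
apply: computable_rec => //; first exact: computable_const.
apply: computable_mul.
  exact: computable_comp (computable_fst computable_id).
exact/computable_snd/computable_snd/computable_id.
Qed.

Definition decidable_pred (P : nat -> bool) := computable (fun n => P n : nat).

Lemma decidable_comp P f : decidable_pred P -> computable f ->
  decidable_pred (fun n => P (f n)).
Proof. by move=> dP cf; exact: (computable_comp dP cf). Qed.

Lemma decidable_neg P : decidable_pred P -> decidable_pred (fun n => ~~ P n).
Proof.
move=> dP; apply: (@eq_computable (fun n => 1 - P n)).
  by move=> n; case: (P n).
by apply: computable_sub => //; exact: computable_const.
Qed.

Lemma decidable_and P Q : decidable_pred P -> decidable_pred Q ->
  decidable_pred (fun n => P n && Q n).
Proof.
move=> dP dQ; apply: (@eq_computable (fun n => P n * Q n)).
  by move=> n; rewrite mulnb.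
exact: computable_mul.
Qed.

Lemma decidable_or P Q : decidable_pred P -> decidable_pred Q ->
  decidable_pred (fun n => P n || Q n).
Proof.
move=> dP dQ; rewrite /decidable_pred.
under eq_fun do rewrite -[_ || _]negbK negb_or.
by apply/decidable_neg/decidable_and; exact: decidable_neg.
Qed.

Lemma decidable_leq f g : computable f -> computable g ->
  decidable_pred (fun n => f n <= g n).
Proof.
move=> cf cg; apply: (@eq_computable (fun n => 1 - (f n - g n))).
  by move=> n; rewrite /leq; case: (f n - g n).
by apply: computable_sub; [exact: computable_const|exact: computable_sub].
Qed.

Lemma decidable_eqn f g : computable f -> computable g ->
  decidable_pred (fun n => f n == g n).
Proof.
move=> cf cg; rewrite /decidable_pred; under eq_fun do rewrite eqn_leq.
by apply: decidable_and; exact: decidable_leq.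
Qed.

Lemma decidable_all f (P : nat -> nat -> bool) : computable f ->
  decidable_pred (fun k => P (nfst k) (nsnd k)) ->
  decidable_pred (fun n => all (P n) (iota 0 (f n))).
Proof.
move=> cf dP; pose step (n k r : nat) := r * P n k.
apply: (@eq_computable (fun n => nat_rect (fun=> nat) 1 (step n) (f n))).
  move=> n; elim: (f n) => [//|k IH].
  by rewrite -[in RHS]addn1 iotaD all_cat /= andbT add0n -mulnb IH.
apply: computable_rec => //; first exact: computable_const.
apply: computable_mul; first exact/computable_snd/computable_snd/computable_id.
apply: (@eq_computable (fun k => let m := npair (nfst k) (nfst (nsnd k)) in
    P (nfst m) (nsnd m))).
  by move=> k /=; rewrite !npairE.
apply: (computable_comp dP).
apply: computable_pair; first exact/computable_fst/computable_id.
exact/computable_fst/computable_snd/computable_id.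
Qed.

(* A finite sequence of numbers is coded by iterated pairing. *)
Definition list_get (W i : nat) : nat :=
  nfst (nat_rect (fun=> nat) W (fun _ r => nsnd r) i).

Lemma list_get_surj (w : nat -> nat) m :
  exists W, forall i, i < m -> list_get W i = w i.
Proof.
have get0 a W : list_get (npair a W) 0 = a by rewrite /list_get /= npairE.
have getS a W i : list_get (npair a W) i.+1 = list_get W i.
  rewrite /list_get; congr nfst.
  by elim: i => [|i /= <-] //=; rewrite npairE.
elim: m w => [|m IH] w; first by exists 0.
have [W WE] := IH (w \o S).
by exists (npair (w 0) W) => -[|i] im; rewrite ?get0 // getS WE.
Qed.

Lemma computable_list_get f g : computable f -> computable g ->
  computable (fun n => list_get (f n) (g n)).
Proof.
move=> cf cg; apply: computable_fst.
apply: (@computable_rec _ _ (fun _ _ r => nsnd r)) => //.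
exact/computable_snd/computable_snd/computable_snd/computable_id.
Qed.

End computable_functions.

Section sigma1.
Local Open Scope nat_scope.

Definition sigma1 (A : set nat) : Prop := exists2 h : nat -> bool,
  decidable_pred h & forall n, A n <-> exists w, h (npair n w).

Lemma eq_sigma1 A B : (forall n, A n <-> B n) -> sigma1 A -> sigma1 B.
Proof. by move=> AB [h dh hA]; exists h => // n; rewrite -AB. Qed.

Lemma sigma1_dec P : decidable_pred P -> sigma1 [set n | P n].
Proof.
move=> dP; exists (fun k => P (nfst k)).
  exact: decidable_comp dP (computable_fst computable_id).
move=> n; split=> /= [Pn|[w]]; last by rewrite npairE.
by exists 0; rewrite npairE.
Qed.

Lemma sigma1T : sigma1 setT.
Proof.
apply: eq_sigma1 (sigma1_dec (computable_const true)) => n.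
by split.
Qed.

Lemma sigma1_eq f g : computable f -> computable g ->
  sigma1 [set n | f n = g n].
Proof.
move=> cf cg; apply: eq_sigma1 (sigma1_dec (decidable_eqn cf cg)) => n.
by split=> /eqP.
Qed.

Lemma sigma1_comp A f : sigma1 A -> computable f -> sigma1 [set n | A (f n)].
Proof.
move=> [h dh hA] cf; exists (fun k => h (npair (f (nfst k)) (nsnd k))).
  apply: decidable_comp => //; apply: computable_pair.
    exact: computable_comp cf (computable_fst computable_id).
  exact/computable_snd/computable_id.
by move=> n /=; rewrite hA; split=> -[w hw]; exists w; rewrite ?npairE in hw *.
Qed.

Lemma sigma1_comp2 (P : nat -> nat -> Prop) f g :
  sigma1 [set k | P (nfst k) (nsnd k)] -> computable f -> computable g ->
  sigma1 [set n | P (f n) (g n)].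
Proof.
move=> sP cf cg; apply: eq_sigma1 (sigma1_comp sP (computable_pair cf cg)).
by move=> n /=; rewrite !npairE.
Qed.

Lemma sigma1_ex (P : nat -> nat -> Prop) :
  sigma1 [set k | P (nfst k) (nsnd k)] -> sigma1 [set n | exists m, P n m].
Proof.
move=> [h dh hP].
exists (fun k => h (npair (npair (nfst k) (nfst (nsnd k))) (nsnd (nsnd k)))).
  apply: decidable_comp => //; apply: computable_pair.
    apply: computable_pair; first exact/computable_fst/computable_id.
    exact/computable_fst/computable_snd/computable_id.
  exact/computable_snd/computable_snd/computable_id.
have PE n m : P n m <-> exists w, h (npair (npair n m) w).
  by rewrite -hP /= !npairE.
move=> n /=; split=> [[m /PE[w hw]]|[w hw]].
  by exists (npair m w); rewrite !npairE.
by exists (nfst w); apply/PE; exists (nsnd w); rewrite !npairE in hw.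
Qed.

Lemma sigma1_ex2 (P Q : nat -> nat -> Prop) :
  sigma1 [set k | P (nfst k) (nsnd k) /\ Q (nfst k) (nsnd k)] ->
  sigma1 [set n | exists2 m, P n m & Q n m].
Proof.
move=> /(@sigma1_ex (fun n m => P n m /\ Q n m)); apply: eq_sigma1 => n.
by split=> [[m []]|[m]]; exists m.
Qed.

Lemma sigma1_and A B : sigma1 A -> sigma1 B -> sigma1 [set n | A n /\ B n].
Proof.
move=> [g dg gA] [h dh hB].
apply: (@eq_sigma1
  [set n | exists w, g (npair n (nfst w)) && h (npair n (nsnd w))]).
  move=> n /=; rewrite gA hB; split.
    by case=> w /andP[gn hn]; split; [exists (nfst w)|exists (nsnd w)].
  by case=> -[w gn] [v hn]; exists (npair w v); rewrite !npairE gn hn.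
apply/sigma1_ex/sigma1_dec/decidable_and;
  apply: decidable_comp => //; apply: computable_pair;
  try exact/computable_fst/computable_id.
  exact/computable_fst/computable_snd/computable_id.
exact/computable_snd/computable_snd/computable_id.
Qed.

Lemma sigma1_and3 A B C : sigma1 A -> sigma1 B -> sigma1 C ->
  sigma1 [set n | [/\ A n, B n & C n]].
Proof.
move=> sA sB sC; apply: eq_sigma1 (sigma1_and sA (sigma1_and sB sC)) => n.
by split=> [[? []]|[]].
Qed.

Lemma sigma1_or A B : sigma1 A -> sigma1 B -> sigma1 [set n | A n \/ B n].
Proof.
move=> [g dg gA] [h dh hB].
exists (fun k => g k || h k); first exact: decidable_or.
move=> n /=; rewrite gA hB; split.
  by case=> -[w hw]; exists w; rewrite hw ?orbT.
by case=> w /orP[] hw; [left|right]; exists w.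
Qed.

Lemma sigma1_all f (P : nat -> nat -> Prop) : computable f ->
  sigma1 [set k | P (nfst k) (nsnd k)] ->
  sigma1 [set n | forall i, i < f n -> P n i].
Proof.
move=> cf [h dh hP].
have PE n i : P n i <-> exists w, h (npair (npair n i) w).
  by rewrite -hP /= !npairE.
pose Q n W i := h (npair (npair n i) (list_get W i)).
apply: (@eq_sigma1 [set n | exists W, all (Q n W) (iota 0 (f n))]).
  move=> n /=; split=> [[W /allP QW] i ifn|Pn].
    by apply/PE; exists (list_get W i); apply: QW; rewrite mem_iota.
  have /choice[w hw] i : exists w, i < f n -> h (npair (npair n i) w).
    have [/Pn/PE[w hw]|_] := ltnP i (f n); first by exists w.
    by exists 0.
  have [W WE] := list_get_surj w (f n).
  by exists W; apply/allP => i; rewrite mem_iota /Q => ifn; rewrite WE ?hw.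
apply/sigma1_ex/sigma1_dec.
apply: (@decidable_all (fun k => f (nfst k)) (fun k => Q (nfst k) (nsnd k))).
  exact: computable_comp cf (computable_fst computable_id).
apply: decidable_comp => //; apply: computable_pair.
  apply: computable_pair.
    exact/computable_fst/computable_fst/computable_id.
  exact/computable_snd/computable_id.
apply: computable_list_get.
  exact/computable_snd/computable_fst/computable_id.
exact/computable_snd/computable_id.
Qed.

End sigma1.

Section rational_codes.
Local Open Scope nat_scope.

Definition rat_code (a b c : nat) : nat := npair (npair a b) c.

Definition posrat_code (k : nat) : nat := rat_code (nfst k).+1 0 (nsnd k).

Definition rat_lt (k l : nat) : bool :=
  nfst (nfst k) * (nsnd l).+1 + nsnd (nfst l) * (nsnd k).+1 <
  nfst (nfst l) * (nsnd k).+1 + nsnd (nfst k) * (nsnd l).+1.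

Definition rat_add (k l : nat) : nat :=
  rat_code (nfst (nfst k) * (nsnd l).+1 + nfst (nfst l) * (nsnd k).+1)
           (nsnd (nfst k) * (nsnd l).+1 + nsnd (nfst l) * (nsnd k).+1)
           ((nsnd k).+1 * (nsnd l).+1).-1.

Definition rat_opp (k : nat) : nat :=
  rat_code (nsnd (nfst k)) (nfst (nfst k)) (nsnd k).

End rational_codes.

(* Solves [computable], [decidable_pred] and [sigma1] goals by following their
   syntax, and resorting to the hypotheses on variable functions and sets. *)
Ltac effective_step :=
  cbv beta delta [mkset setT];
  match goal with
  | |- computable nfst => exact: (computable_fst computable_id)
  | |- computable nsnd => exact: (computable_snd computable_id)
  | |- computable S => exact: (computable_succ computable_id)
  | |- computable (muln _) => apply: computable_mul
  | |- computable (fun n => n) => exact: computable_id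
  | |- computable (fun _ => ?c) => exact: (computable_const c)
  | |- computable (fun n => nfst _) => apply: computable_fst
  | |- computable (fun n => nsnd _) => apply: computable_snd
  | |- computable (fun n => npair _ _) => apply: computable_pair
  | |- computable (fun n => list_get _ _) => apply: computable_list_get
  | |- computable (fun n => S _) => apply: computable_succ
  | |- computable (fun n => predn _) => apply: computable_pred
  | |- computable (fun n => addn _ _) => apply: computable_add
  | |- computable (fun n => muln _ _) => apply: computable_mul
  | |- computable (fun n => expn _ _) => apply: computable_exp
  | |- computable (fun n => rat_code _ _ _) => rewrite /rat_code
  | |- computable (fun n => posrat_code _) => rewrite /posrat_code
  | |- computable (fun n => rat_add _ _) => rewrite /rat_add
  | |- computable (fun n => rat_opp _) => rewrite /rat_opp
  | |- computable (fun n => ?h (@?g n)) =>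
      is_var h; apply: (@computable_comp h g)
  | |- decidable_pred (fun n => _ && _) => apply: decidable_and
  | |- decidable_pred (fun n => ~~ _) => apply: decidable_neg
  | |- decidable_pred (fun n => leq _ _) => apply: decidable_leq
  | |- decidable_pred (fun n => rat_lt _ _) => rewrite /rat_lt
  | |- decidable_pred (fun n => ?h (@?g n)) =>
      is_var h; apply: (@decidable_comp h g)
  | |- sigma1 (fun _ => True) => exact: sigma1T
  | |- sigma1 (fun n => is_true (@?b n)) => apply: (@sigma1_dec b)
  | |- sigma1 (fun n => @eq nat _ _) => apply: sigma1_eq
  | |- sigma1 (fun n => exists m, @?P n m) => apply: (@sigma1_ex P)
  | |- sigma1 (fun n => exists2 m, @?P n m & @?Q n m) =>
      apply: (@sigma1_ex2 P Q)
  | |- sigma1 (fun n => @?A n /\ @?B n) => apply: (@sigma1_and A B)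
  | |- sigma1 (fun n => [/\ @?A n, @?B n & @?C n]) =>
      apply: (@sigma1_and3 A B C)
  | |- sigma1 (fun n => @?A n \/ @?B n) => apply: (@sigma1_or A B)
  | |- sigma1 (fun n => forall i, is_true (leq (S i) (@?f n)) -> @?P n i) =>
      apply: (@sigma1_all f P)
  | sA : sigma1 ?A |- sigma1 (fun n => ?A (@?g n)) => apply: (sigma1_comp sA)
  | sP : sigma1 [set k | ?P (nfst k) (nsnd k)] |-
      sigma1 (fun n => ?P (@?f n) (@?g n)) => apply: (@sigma1_comp2 P f g sP)
  end.

Ltac effective := repeat first [assumption | effective_step].

Section ce_sets.
Local Open Scope nat_scope.

Lemma evals_Prec0 f g a m : evals (Prec f g) (npair a 0) m <-> evals f a m.
Proof. by rewrite /= !npairE. Qed.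

Lemma evals_PrecS f g a n m : evals (Prec f g) (npair a n.+1) m <->
  exists2 r, evals (Prec f g) (npair a n) r & evals g (npair a (npair n r)) m.
Proof. by rewrite /= !npairE. Qed.

Lemma evals_Prec_trace f g a n m : evals (Prec f g) (npair a n) m <->
  exists W, [/\ evals f a (list_get W 0),
    forall i, i < n ->
      evals g (npair a (npair i (list_get W i))) (list_get W i.+1) &
    list_get W n = m].
Proof.
split=> [|[W [W0 WS <-]]]; last first.
  elim: n WS => [_|n IHn WS]; first exact/evals_Prec0.
  apply/evals_PrecS; exists (list_get W n); last exact: WS.
  by apply: IHn => i /ltnW; exact: WS.
elim: n m => [|n IHn] m.
  move=> /evals_Prec0 fm; have [W /(_ 0 isT) W0] := list_get_surj (fun=> m) 1.
  by exists W; rewrite W0.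
move=> /evals_PrecS[r /IHn[W [W0 WS Wr]] gm].
have [V VE] := list_get_surj (fun i => if i <= n then list_get W i else m) n.+2.
exists V; split; [by rewrite VE| |by rewrite VE ?ltnn].
move=> i; rewrite ltnS => i_n; rewrite !VE ?ltnS ?(leqW i_n)// i_n.
case: ltnP => [/WS//|n_i].
by have -> : i = n; [apply/eqP; rewrite eqn_leq i_n|rewrite Wr].
Qed.

Lemma sigma1_evals c : sigma1 [set k | evals c (nfst k) (nsnd k)].
Proof.
elim: c => [||||f IHf g IHg|f IHf g IHg|f IHf g IHg|f IHf].
1-6,8: by rewrite /=; effective.
apply: (@eq_sigma1 [set k | exists W,
    [/\ evals f (nfst (nfst k)) (list_get W 0),
        forall i, i < nsnd (nfst k) ->
          evals g (npair (nfst (nfst k)) (npair i (list_get W i)))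
            (list_get W i.+1) &
        list_get W (nsnd (nfst k)) = nsnd k]]); last by effective.
by move=> k; rewrite /mkset -evals_Prec_trace npair_fst_snd.
Qed.

Lemma evals_functional c n a b : evals c n a -> evals c n b -> a = b.
Proof.
elim: c n a b => [||||f IHf g IHg|f IHf g IHg|f IHf g IHg|f IHf] n a b /=;
  try by move=> -> ->.
- move=> [a1 [a2 [fa ga ->]]] [b1 [b2 [fb gb ->]]].
  by rewrite (IHf _ _ _ fa fb) (IHg _ _ _ ga gb).
- move=> [a1 ga fa] [b1 gb fb].
  by rewrite (IHg _ _ _ ga gb) in fa; exact: IHf fa fb.
- move: (nfst n) (nsnd n) => k m.
  elim: m a b => [|m IHm] a b; first exact: IHf.
  move=> [r1 fa ga] [r2 fb gb].
  by rewrite (IHm _ _ fa fb) in ga; exact: IHg ga gb.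
- move=> [fa a_min] [fb b_min].
  case: (ltngtP a b) => // [/b_min|/a_min] [r fr].
    by have := IHf _ _ _ fa fr.
  by have := IHf _ _ _ fb fr.
Qed.

Lemma ce_sigma1 A : ce A <-> sigma1 A.
Proof.
split=> [[c ->]|[h dh hA]].
  exact: (@sigma1_ex (evals c) (sigma1_evals c)).
have [d dE] : computable (fun k => ~~ h k) by exact: decidable_neg.
exists (Mini d); apply/seteqP; split=> [n /hA hn|n [m [dm _]]].
  have [w hw w_min] := ex_minnP hn.
  exists w; split; first by have := dE (npair n w); rewrite hw.
  move=> i iw; exists 0; have := dE (npair n i).
  by case: (boolP (h (npair n i))) => // /w_min; rewrite leqNgt iw.
apply/hA; exists m; have := evals_functional dm (dE _).
by case: (h _).
Qed.

Lemma code_num_inj : injective code_num.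
Proof.
elim=> [||||f IHf g IHg|f IHf g IHg|f IHf g IHg|f IHf]
  [||||f' g'|f' g'|f' g'|f'] // /npair_inj[] // _;
  by [move=> /npair_inj[/IHf -> /IHg ->]|move=> /IHf ->].
Qed.

Lemma ce_set_code_num c : ce_set (code_num c) = halting c.
Proof.
apply/seteqP; split=> [n [d /code_num_inj ->]//|n hn].
by exists c.
Qed.

Lemma sigma1_ce_set e : sigma1 (ce_set e).
Proof.
have [[c <-]|no_code] := pselect (exists c, code_num c = e).
  by rewrite ce_set_code_num; apply/ce_sigma1; exists c.
apply: (@eq_sigma1 [set n | n.+1 <= n]); last by effective.
by move=> n; rewrite /= ltnn; split=> // -[c ce _]; case: no_code; exists c.
Qed.

Lemma computable_code_num_const : computable (fun k => code_num (const_code k)).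
Proof.
pose step (n k r : nat) := npair 5 (npair (npair 1 0) r).
apply: (@eq_computable
  (fun n => nat_rect (fun=> nat) (npair 0 0) (step n) n)).
  by elim=> //= n ->.
by apply: computable_rec; rewrite /step; effective.
Qed.

Lemma smn_ce_set B : ce B ->
  exists2 e, computable e & forall i, ce_set (e i) = slice B i.
Proof.
move=> [c ->].
exists (fun i => code_num (Comp c (Pair (const_code i) (Pair Fst Snd)))).
  have cconst := computable_code_num_const.
  by rewrite [fun i => _]/=; effective.
move=> i; rewrite ce_set_code_num; apply/seteqP; split=> n [m] /=.
  case=> a [a1 [a2 [/evals_const_code -> [b1 [b2 [-> -> ->]]] ->]]] hm.
  by exists m; rewrite npair_fst_snd in hm.
move=> hm; exists m, (npair i n) => //; exists i, n; split=> //.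
  exact/evals_const_code.
by exists (nfst n), (nsnd n); rewrite npair_fst_snd.
Qed.

End ce_sets.

Section rational_code_values.

Lemma rat_num_code a b c :
  rat_num (rat_code a b c) = (a%:R - b%:R) / c.+1%:R.
Proof. by rewrite /rat_num !npairE. Qed.

Lemma rat_numE k : rat_num k =
  ((nfst (nfst k))%:R - (nsnd (nfst k))%:R) / (nsnd k).+1%:R.
Proof. by []. Qed.

Lemma rat_num_posrat_code k : rat_num (posrat_code k) = posrat_num k.
Proof. by rewrite rat_num_code subr0. Qed.

Lemma rat_num_add k l : rat_num (rat_add k l) = rat_num k + rat_num l.
Proof.
rewrite rat_num_code prednK ?muln_gt0// !rat_numE !natrD !natrM.
have : ((nsnd k).+1%:R : rat) != 0 by rewrite pnatr_eq0.
have : ((nsnd l).+1%:R : rat) != 0 by rewrite pnatr_eq0.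
by move=> ? ?; field; apply/andP.
Qed.

Lemma rat_num_opp k : rat_num (rat_opp k) = - rat_num k.
Proof. by rewrite rat_num_code rat_numE -mulNr opprB. Qed.

Lemma denq_succ (r : rat) : exists d : nat, denq r = d.+1%:Z.
Proof. by have := denq_gt0 r; case: (denq r) => // -[|d] // _; exists d. Qed.

Lemma rat_num_surj (r : rat) : exists k, rat_num k = r.
Proof.
have [d dE] := denq_succ r.
rewrite -[r]divq_num_den dE; case: (numq r) => n.
  by exists (rat_code n 0 d); rewrite rat_num_code subr0.
by exists (rat_code 0 n.+1 d); rewrite rat_num_code sub0r NegzE rmorphN.
Qed.

Lemma posrat_num_surj (r : rat) : 0 < r -> exists k, posrat_num k = r.
Proof.
have [d dE] := denq_succ r.
rewrite -numq_gt0; have := divq_num_den r; rewrite dE.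
case: (numq r) => // -[|n] // <- _.
by exists (npair n d); rewrite /posrat_num !npairE.
Qed.

Variable R : realType.

Lemma rat_ltE k l :
  rat_lt k l = (ratr (rat_num k) < ratr (rat_num l) :> R).
Proof.
rewrite ltr_rat !rat_numE ltr_pdivrMr ?ltr0n// mulrAC ltr_pdivlMr ?ltr0n//.
by rewrite !mulrBl ltrBlDr addrAC ltrBrDr /rat_lt -!natrM -!natrD ltr_nat.
Qed.

Lemma ratr_code a b c :
  ratr (rat_num (rat_code a b c)) = (a%:R - b%:R) / c.+1%:R :> R.
Proof. by rewrite rat_num_code fmorph_div /= rmorphB /= !ratr_nat. Qed.

Lemma ratr_code_pred a b c : (0 < c)%N ->
  ratr (rat_num (rat_code a b c.-1)) = (a%:R - b%:R) / c%:R :> R.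
Proof. by move=> c0; rewrite ratr_code prednK. Qed.

Lemma posrat_num_between (a b : R) : 0 <= a -> a < b ->
  exists2 k, a < ratr (posrat_num k) & ratr (posrat_num k) < b.
Proof.
move=> a0 /rat_in_itvoo[q]; rewrite in_itv /= => /andP[aq qb].
have /posrat_num_surj[k qE] : 0 < q by rewrite -(@ltr0q R) (le_lt_trans a0).
by exists k; rewrite qE.
Qed.

Lemma sigma1_lt_computable_real (a : nat -> R) : unif_computable_real a ->
  sigma1 [set k | ratr (rat_num (nfst k)) < a (nsnd k)].
Proof.
move=> [h ch hE].
apply: (@eq_sigma1 [set k | exists m,
   rat_lt (rat_add (nfst k) (rat_code 1 0 (2 ^ m).-1)) (h (npair (nsnd k) m))]);
  last by effective.
move=> k /=; set q : R := ratr _; set x := a _.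
have ltE m : rat_lt (rat_add (nfst k) (rat_code 1 0 (2 ^ m).-1))
    (h (npair (nsnd k) m)) =
    (q + 2 ^- m < ratr (rat_num (h (npair (nsnd k) m)))).
  rewrite rat_ltE rat_num_add rmorphD /= ratr_code_pred ?expn_gt0//.
  by rewrite subr0 natrX mul1r.
split=> [[m]|qx].
  rewrite ltE; have := hE (nsnd k) m; rewrite -/x ler_norml => /andP[+ _].
  by lra.
have gap0 : 0 < (x - q) / 2 by rewrite divr_gt0// subr_gt0.
have [m _ /(_ m (leqnn m))/= m_gap] := near_infty_natSinv_expn_lt (PosNum gap0).
exists m; rewrite ltE; have := hE (nsnd k) m; rewrite -/x ler_norml => /andP[_].
by move: m_gap; rewrite div1r; lra.
Qed.

Lemma unif_computable_realN (a : nat -> R) :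
  unif_computable_real a -> unif_computable_real (fun i => - a i).
Proof.
move=> [h ch hE]; exists (fun n => rat_opp (h n)); first by effective.
by move=> i k; rewrite rat_num_opp rmorphN -opprD normrN; exact: hE.
Qed.

Lemma sigma1_gt_computable_real (a : nat -> R) : unif_computable_real a ->
  sigma1 [set k | a (nsnd k) < ratr (rat_num (nfst k))].
Proof.
move=> /unif_computable_realN/sigma1_lt_computable_real sa.
have copp : computable (fun k => npair (rat_opp (nfst k)) (nsnd k)).
  by effective.
apply: eq_sigma1 (sigma1_comp sa copp) => k /=.
by rewrite !npairE rat_num_opp rmorphN ltrN2.
Qed.

End rational_code_values.

(** * Uniformly c.e. open sets *)

Section balls.
Context {R : realType} {X : completeMetricType R}.
Variable s : nat -> X.

Definition ball_center k : X := s (nfst k).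

Definition ball_radius k : R := ratr (posrat_num (nsnd k)).

Definition closed_basic_ball k : set X :=
  [set y | mdist (ball_center k) y <= ball_radius k].

Lemma basic_ballE k y :
  basic_ball s k y = (mdist (ball_center k) y < ball_radius k).
Proof. by rewrite /basic_ball ballEmdist. Qed.

Lemma closed_basic_ballC k y :
  (~` closed_basic_ball k) y = (ball_radius k < mdist (ball_center k) y).
Proof.
rewrite /closed_basic_ball /setC /= ltNge.
by apply/propext; split=> /negP.
Qed.

Lemma basic_ball_subset_closed k : basic_ball s k `<=` closed_basic_ball k.
Proof. by move=> y; rewrite basic_ballE => /ltW. Qed.

Lemma basic_ball_near (y : X) (e : R) : dense (range s) -> 0 < e ->
  exists b,
    [/\ basic_ball s b y, mdist (ball_center b) y < e & ball_radius b < e].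
Proof.
move=> s_dense e0.
have [z [yz [i _ iz]]] : (ball y e)° `&` range s !=set0.
  apply: s_dense; last exact: open_interior.
  by exists y; exact: nbhsx_ballx.
move: yz; rewrite -iz => /interior_subset.
rewrite ballEmdist /= metric_sym => yi.
have [k dk ke] := posrat_num_between (mdist_ge0 (s i) y) yi.
by exists (npair i k); rewrite basic_ballE /ball_center /ball_radius !npairE.
Qed.

(* Unlike inclusion and disjointness of balls, these are c.e. relations. *)
Definition formally_inside b k : Prop :=
  mdist (ball_center b) (ball_center k) < ball_radius k - ball_radius b.

Definition formally_outside b k : Prop :=
  ball_radius k + ball_radius b < mdist (ball_center b) (ball_center k).

Lemma formally_inside_sub b k :
  formally_inside b k -> basic_ball s b `<=` basic_ball s k.
Proof.
move=> bk y; rewrite !basic_ballE => yb.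
have := metric_triangle (ball_center k) (ball_center b) y.
rewrite (metric_sym (ball_center k) (ball_center b)).
by move: bk yb; rewrite /formally_inside; lra.
Qed.

Lemma formally_outside_sub b k :
  formally_outside b k -> basic_ball s b `<=` ~` closed_basic_ball k.
Proof.
move=> bk y; rewrite basic_ballE closed_basic_ballC => yb.
have := metric_triangle (ball_center b) y (ball_center k).
by rewrite (metric_sym y); move: bk yb; rewrite /formally_outside; lra.
Qed.

Lemma formally_inside_near k y : basic_ball s k y ->
  \forall e \near 0^'+, forall b,
    mdist (ball_center b) y < e -> ball_radius b < e -> formally_inside b k.
Proof.
rewrite basic_ballE => yk; near=> e => b yb be.
have := metric_triangle (ball_center b) y (ball_center k).
rewrite (metric_sym y) /formally_inside.
suff : e < (ball_radius k - mdist (ball_center k) y) / 2 by lra.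
by near: e; apply: nbhs_right_lt; lra.
Unshelve. all: end_near. Qed.

Lemma formally_outside_near k y : (~` closed_basic_ball k) y ->
  exists2 e : R, 0 < e & forall b,
    mdist (ball_center b) y < e -> ball_radius b < e -> formally_outside b k.
Proof.
rewrite closed_basic_ballC => yk.
exists ((mdist (ball_center k) y - ball_radius k) / 2).
  by rewrite divr_gt0// subr_gt0.
move=> b yb be; have := metric_triangle (ball_center k) (ball_center b) y.
by rewrite (metric_sym (ball_center k) (ball_center b)) /formally_outside; lra.
Qed.

Lemma basic_ball_shrink k y : basic_ball s k y ->
  exists l,
    [/\ nfst l = nfst k, ball_radius l < ball_radius k & basic_ball s l y].
Proof.
rewrite basic_ballE => /(posrat_num_between (mdist_ge0 _ _))[r yr rk].
exists (npair (nfst k) r).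
by rewrite basic_ballE /ball_center /ball_radius !npairE.
Qed.

Hypothesis s_computable : unif_computable_real
  (fun k => mdist (s (nfst k)) (s (nsnd k)) : R).

Lemma sigma1_formally_inside :
  sigma1 [set k | formally_inside (nfst k) (nsnd k)].
Proof.
pose gap k := rat_add (posrat_code (nsnd (nsnd k)))
                      (rat_opp (posrat_code (nsnd (nfst k)))).
have cgap : computable (fun k => npair (gap k)
    (npair (nfst (nfst k)) (nfst (nsnd k)))) by rewrite /gap; effective.
apply: eq_sigma1 (sigma1_comp (sigma1_gt_computable_real s_computable) cgap).
move=> k /=; rewrite !npairE rat_num_add rat_num_opp !rat_num_posrat_code.
by rewrite rmorphB.
Qed.

Lemma sigma1_formally_outside :
  sigma1 [set k | formally_outside (nfst k) (nsnd k)].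
Proof.
pose sum k := rat_add (posrat_code (nsnd (nsnd k)))
                      (posrat_code (nsnd (nfst k))).
have csum : computable (fun k => npair (sum k)
    (npair (nfst (nfst k)) (nfst (nsnd k)))) by rewrite /sum; effective.
apply: eq_sigma1 (sigma1_comp (sigma1_lt_computable_real s_computable) csum).
by move=> k /=; rewrite !npairE rat_num_add !rat_num_posrat_code rmorphD.
Qed.

End balls.

Section unif_ce_open.
Context {R : realType} {X : completeMetricType R}.
Variable s : nat -> X.

Lemma open_ball (x : X) (r : R) : open (ball x r).
Proof.
rewrite openE => y; rewrite ballEmdist /= => xy; apply/nbhs_ballP.
exists (r - mdist x y); first by rewrite /= subr_gt0.
move=> z; rewrite ballEmdist /= ltrBrDl; apply: le_lt_trans.
exact: metric_triangle.
Qed.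

Lemma open_open_of A : open (open_of s A).
Proof. by apply: bigcup_open => k _; exact: open_ball. Qed.

Lemma measurable_ce_open e : measurable (ce_open s e : set (borel X)).
Proof. by apply: sub_sigma_algebra; exact: open_open_of. Qed.

Lemma open_ofT : dense (range s) -> open_of s setT = setT.
Proof.
move=> s_dense; apply/seteqP; split=> // y _.
by have [b [yb _ _]] := basic_ball_near y s_dense ltr01; exists b.
Qed.

Lemma unif_ce_openP (U : nat -> set X) : unif_ce_open s U <->
  exists2 P : nat -> set nat, sigma1 [set k | P (nfst k) (nsnd k)] &
    forall i, U i = open_of s (P i).
Proof.
split=> [[A /ce_sigma1 sA UA]|[P sP UP]].
  exists (slice A) => //; apply: eq_sigma1 sA => k.
  by rewrite /slice /= npair_fst_snd.
exists [set k | P (nfst k) (nsnd k)]; first exact/ce_sigma1.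
move=> i; rewrite UP; congr open_of; apply/funext => k.
by rewrite /slice /= !npairE.
Qed.

Lemma unif_ce_open_index (U : nat -> set X) : unif_ce_open s U ->
  exists2 e, computable e & forall i, U i = ce_open s (e i).
Proof.
move=> [A /smn_ce_set[e ce eA] UA]; exists e => // i.
by rewrite UA /ce_open eA.
Qed.

Lemma measurable_unif_ce_open (U : nat -> set X) i :
  unif_ce_open s U -> measurable (U i : set (borel X)).
Proof. by move=> /unif_ce_open_index[e _ ->]; exact: measurable_ce_open. Qed.

Lemma unif_ce_open_cst e : unif_ce_open s (fun=> ce_open s e).
Proof.
apply/unif_ce_openP; exists (fun=> ce_set e) => //.
have se := sigma1_ce_set e.
by effective.
Qed.

Lemma unif_ce_open_basic_ball : unif_ce_open s (basic_ball s).
Proof.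
apply/unif_ce_openP; exists (fun i => [set k | k = i]); first by effective.
by move=> i; rewrite /open_of bigcup_set1.
Qed.

Lemma unif_ce_open_comp (U : nat -> set X) f :
  unif_ce_open s U -> computable f -> unif_ce_open s (fun i => U (f i)).
Proof.
move=> /unif_ce_openP[P sP UP] cf; apply/unif_ce_openP.
by exists (fun i => P (f i)) => //; effective.
Qed.

Lemma unif_ce_open_bigcup (D : nat -> set nat) (U : nat -> nat -> set X) :
  sigma1 [set k | D (nfst k) (nsnd k)] ->
  unif_ce_open s (fun k => U (nfst k) (nsnd k)) ->
  unif_ce_open s (fun i => \bigcup_(j in D i) U i j).
Proof.
move=> sD /unif_ce_openP[P sP UP]; apply/unif_ce_openP.
exists (fun i => [set k | exists2 j, D i j & P (npair i j) k]).
  by effective.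
have UE i j : U i j = open_of s (P (npair i j)) by rewrite -UP !npairE.
move=> i; apply/seteqP; split=> y.
  by move=> [j Dij]; rewrite UE => -[k Pk yk]; exists k => //; exists j.
by move=> [k [j Dij Pk] yk]; exists j => //; rewrite UE; exists k.
Qed.

Lemma unif_ce_open_and (D : set nat) (U : nat -> set X) : sigma1 D ->
  unif_ce_open s U -> unif_ce_open s (fun i => [set y | D i /\ U i y]).
Proof.
move=> sD /unif_ce_openP[P sP UP]; apply/unif_ce_openP.
exists (fun i => [set k | D i /\ P i k]); first by effective.
move=> i; apply/seteqP; split=> y /=; rewrite UP.
  by move=> [Di [k Pk yk]]; exists k.
by move=> [k [Di Pk] yk]; split=> //; exists k.
Qed.

Lemma unif_ce_open_or (D : set nat) (U : nat -> set X) : dense (range s) ->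
  sigma1 D -> unif_ce_open s U ->
  unif_ce_open s (fun i => [set y | D i \/ U i y]).
Proof.
move=> s_dense sD /unif_ce_openP[P sP UP]; apply/unif_ce_openP.
exists (fun i => [set k | D i \/ P i k]); first by effective.
move=> i; apply/seteqP; split=> y /=; rewrite UP.
  move=> [Di|[k Pk yk]]; last by exists k => //; right.
  have : open_of s setT y by rewrite open_ofT.
  by move=> [k _ yk]; exists k => //; left.
by move=> [k [Di|Pk] yk]; [left|right; exists k].
Qed.

Hypothesis s_polish : computable_polish s.

Lemma unif_ce_open_bigcap (n : nat -> nat) (U : nat -> nat -> set X) :
  computable n -> unif_ce_open s (fun k => U (nfst k) (nsnd k)) ->
  unif_ce_open s (fun i => \bigcap_(j < n i) U i j).
Proof.
have [s_dense s_computable] := s_polish.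
move=> cn /unif_ce_openP[P sP UP]; apply/unif_ce_openP.
have s_inside := sigma1_formally_inside s_computable.
exists (fun i => [set b | forall j, (j < n i)%N ->
    exists k, P (npair i j) k /\ formally_inside s b k]); first by effective.
have UE i j : U i j = open_of s (P (npair i j)) by rewrite -UP !npairE.
move=> i; apply/seteqP; split=> y; last first.
  move=> [b b_inside yb] j /b_inside[k [Pk /formally_inside_sub bk]].
  by rewrite UE; exists k => //; exact: bk.
move=> yU; have : \forall e \near 0^'+, forall j : 'I_(n i), forall b,
    mdist (ball_center s b) y < e -> ball_radius b < e ->
    exists k, P (npair i j) k /\ formally_inside s b k.
  apply: filter_forall => j; have := yU j (ltn_ord j).
  rewrite UE => -[k Pk /formally_inside_near].
  apply: filterS => e inside b yb be.
  by exists k; split=> //; exact: inside.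
move=> /(filterI (nbhs_right_gt (0 : R)))/filter_ex[e [e0 inside]].
have [b [yb cb rb]] := basic_ball_near y s_dense e0.
by exists b => // j jn; exact: inside (Ordinal jn) b cb rb.
Qed.

Lemma unif_ce_open_closed_basic_ballC :
  unif_ce_open s (fun k => ~` closed_basic_ball s k).
Proof.
have [s_dense s_computable] := s_polish.
apply/unif_ce_openP.
have s_outside := sigma1_formally_outside s_computable.
exists (fun k => [set b | formally_outside s b k]).
  by apply: (@sigma1_comp2 (formally_outside s)) => //; effective.
move=> k; apply/seteqP; split=> y; last first.
  by move=> [b /formally_outside_sub]; exact.
move=> /formally_outside_near[e e0 outside].
have [b [yb cb rb]] := basic_ball_near y s_dense e0.
by exists b => //; exact: outside.
Qed.

(* [h j] means that the ball [nfst j] is found, at stage [nsnd j], to be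
   concentric with, and smaller than, a ball of [ce_set e]. *)
Lemma ce_open_closed_balls e : exists h : nat -> bool, [/\ decidable_pred h,
  ce_open s e `<=` \bigcup_(j in [set j | h j]) basic_ball s (nfst j) &
  forall j, h j -> closed_basic_ball s (nfst j) `<=` ce_open s e].
Proof.
pose A := [set k | exists2 l, ce_set e l &
  nfst k = nfst l /\ rat_lt (posrat_code (nsnd k)) (posrat_code (nsnd l))].
have [h dh hA] : sigma1 A.
  by have se := sigma1_ce_set e; rewrite /A; effective.
have ltE k l : rat_lt (posrat_code (nsnd k)) (posrat_code (nsnd l)) =
    (ball_radius k < ball_radius l :> R).
  by rewrite (rat_ltE R) !rat_num_posrat_code.
exists h; split=> // [y [l el /basic_ball_shrink[k [kl kl_lt yk]]]|j hj y yj].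
  have /hA[w hw] : A k by exists l => //; rewrite ltE.
  by exists (npair k w); rewrite //= npairE.
have /hA[l el [jl]] : exists w, h (npair (nfst j) w).
  by exists (nsnd j); rewrite npair_fst_snd.
rewrite ltE => jl_lt; exists l => //; rewrite basic_ballE /ball_center -jl.
exact: le_lt_trans jl_lt.
Qed.

Lemma ce_open_exhaustion e : exists U W : nat -> set X,
  [/\ unif_ce_open s U, unif_ce_open s W, nondecreasing_seq U,
      \bigcup_n U n = ce_open s e &
      forall n, U n `<=` ~` W n /\ ~` W n `<=` ce_open s e].
Proof.
have [h [dh e_h h_e]] := ce_open_closed_balls e.
pose inner n := \bigcup_(j in [set j | (j < n)%N && h j]) basic_ball s (nfst j).
pose outer j := [set y | ~~ h j \/ (~` closed_basic_ball s (nfst j)) y].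
exists inner, (fun n => \bigcap_(j < n) outer j); split.
- apply: (@unif_ce_open_bigcup _ (fun _ j => basic_ball s (nfst j))).
    by effective.
  by apply: unif_ce_open_comp unif_ce_open_basic_ball _; effective.
- apply: unif_ce_open_bigcap; first by effective.
  apply: (@unif_ce_open_comp outer); last by effective.
  apply: unif_ce_open_or s_polish.1 _ _; first by effective.
  by apply: unif_ce_open_comp unif_ce_open_closed_basic_ballC _; effective.
- move=> m n mn; apply/subsetPset => y [j /andP[jm hj] yj].
  by exists j => //=; rewrite hj (leq_trans jm mn).
- apply/seteqP; split=> [y [n _ [j /andP[_ hj] /basic_ball_subset_closed]]|y].
    exact: h_e.
  by move=> /e_h[j hj yj]; exists j.+1 => //; exists j; rewrite //= ltnSn.
- move=> n; split=> y.
    move=> [j /andP[jn hj] /basic_ball_subset_closed yj] /(_ j jn)[|//].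
    by rewrite hj.
  move=> /existsNP[j /not_implyP[_ /not_orP[/negP/negPn hj /contrapT]]].
  exact: h_e.
Qed.

End unif_ce_open.

(** * Integrals and superlevel sets *)

Section extended_reals.
Context {R : realType}.
Local Open Scope ereal_scope.

Lemma rat_between_ereal (r : R) (z : \bar R) :
  r%:E < z -> exists2 q : rat, (r < ratr q)%R & (ratr q)%:E < z.
Proof.
case: z => [t /rat_in_itvoo[q]|_|//].
  by rewrite in_itv => /andP[]; exists q.
have /rat_in_itvoo[q] : (r < r + 1)%R by rewrite ltrDl.
by rewrite in_itv => /andP[rq _]; exists q => //; exact: ltry.
Qed.

Lemma ereal_cvg_gt (u : nat -> \bar R) (l r : \bar R) :
  u n @[n --> \oo] --> l -> r < l -> \forall n \near \oo, r < u n.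
Proof. by move=> ul rl; exact: (ul _ (open_ereal_gt' rl)). Qed.

Lemma ereal_cvg_lt (u : nat -> \bar R) (l r : \bar R) :
  u n @[n --> \oo] --> l -> l < r -> \forall n \near \oo, u n < r.
Proof. by move=> ul lr; exact: (ul _ (open_ereal_lt' lr)). Qed.

Lemma cvg_EFin_lt (u : nat -> \bar R) (l : R) :
  (forall r, (r < l)%R -> \forall n \near \oo, r%:E < u n) ->
  (forall r, (l < r)%R -> \forall n \near \oo, u n < r%:E) ->
  u n @[n --> \oo] --> l%:E.
Proof.
move=> lu ul A [e /= e0 eA].
have [le_l l_le] : (l - e < l)%R /\ (l < l + e)%R by lra.
apply: filterS (filterI (lu _ le_l) (ul _ l_le)) => n /= [].
case: (u n) => [r| |//]; last by rewrite [+oo < _]ltNge leey.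
rewrite !lte_fin => ler rle; apply: (eA r).
by rewrite /= distrC ltr_distl ler rle.
Qed.

Lemma nneseries_ge_term (u : nat -> \bar R) k :
  (forall n, 0 <= u n) -> u k <= \sum_(0 <= i <oo) u i.
Proof.
move=> u0; rewrite (nneseriesD1 (n := k))// leeDl//.
by apply: nneseries_ge0 => n _ _.
Qed.

Lemma poweR_ereal_sup_le (u : nat -> \bar R) (p : R) :
  (0 < p)%R -> (forall k, 0 <= u k) ->
  ereal_sup (range u) `^ p <= \sum_(0 <= k <oo) u k `^ p.
Proof.
move=> p0 u0; set S := \sum_(0 <= k <oo) _.
have S0 : 0 <= S by apply: nneseries_ge0 => k _ _; exact: poweR_ge0.
have in0y (z : \bar R) : 0 <= z -> z \in `[0, +oo].
  by move=> z0; rewrite in_itv /= z0 leey.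
have supS : ereal_sup (range u) <= S `^ p^-1.
  apply: ge_ereal_sup => _ [k _ <-].
  rewrite -[u k]poweRe1// -(mulfV (lt0r_neq0 p0)) poweRrM.
  apply: gt0_ler_poweR; rewrite ?invr_ge0 ?in0y ?poweR_ge0 ?(ltW p0)//.
  exact: (nneseries_ge_term k (fun n => poweR_ge0 (u n) p)).
have sup0 : 0 <= ereal_sup (range u).
  by apply: le_trans (u0 0%N) _; apply: ereal_sup_ubound; exists 0%N.
have := gt0_ler_poweR (ltW p0) (in0y _ sup0) (in0y _ (poweR_ge0 _ _)) supS.
by rewrite -poweRrM mulVf ?gt_eqF// poweRe1.
Qed.

End extended_reals.

Section measures.
Context {R : realType} {d : measure_display} {T : measurableType d}.
Variable mu : {measure set T -> \bar R}.
Local Open Scope ereal_scope.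

Lemma measure_le_geometric_ge0 (V : nat -> set T) (C z : R) (c : nat) :
  (forall i, mu (V i) <= (C / z ^+ (c * i))%:E) -> (0 <= C)%R.
Proof.
move=> /(_ 0%N)/(le_trans (measure_ge0 mu _)).
by rewrite muln0 expr0 divr1 lee_fin.
Qed.

Lemma measurable_scaled_indic (a : R) (V : set T) : measurable V ->
  measurable_fun setT (fun y => a%:E * (\1_V y)%:E).
Proof.
move=> mV; apply: measurable_funeM; apply/measurable_EFinP.
exact: measurable_indic.
Qed.

Lemma integral_scaled_indic_series (a : nat -> R) (V : nat -> set T) :
  (forall i, 0 <= a i)%R -> (forall i, measurable (V i)) ->
  \int[mu]_y (\sum_(0 <= i <oo) (a i)%:E * (\1_(V i) y)%:E) =
  \sum_(0 <= i <oo) (a i)%:E * mu (V i).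
Proof.
move=> a0 mV; rewrite integral_nneseries//.
- apply: eq_eseriesr => i _.
  rewrite ge0_integralZl ?integral_indic ?setIT ?lee_fin//.
  by apply/measurable_EFinP; exact: measurable_indic.
- by move=> i; exact: measurable_scaled_indic.
- by move=> i y _; rewrite mule_ge0 ?lee_fin.
Qed.

End measures.

Section superlevel_sets.
Context {R : realType} {d : measure_display} {T : measurableType d}.
Variables (mu : {measure set T -> \bar R}) (f : T -> \bar R).
Hypotheses (mf : measurable_fun setT f) (f_ge0 : forall y, (0 <= f y)%E).
Local Open Scope ereal_scope.

Lemma measurable_superlevel (a : \bar R) : measurable [set y | a < f y].
Proof.
by rewrite -[X in measurable X]setTI; exact: emeasurable_fun_o_infty.
Qed.

Lemma integral_ge_cst (D : set T) (c : \bar R) : measurable D -> 0 <= c ->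
  (forall y, D y -> c <= f y) -> c * mu D <= \int[mu]_(y in D) f y.
Proof.
move=> mD c0 cf; rewrite -integral_cst//; apply: ge0_le_integral => //.
exact: measurable_funTS.
Qed.

Lemma integral_le_cst (D : set T) (c : \bar R) : measurable D -> 0 <= c ->
  (forall y, D y -> f y <= c) -> \int[mu]_(y in D) f y <= c * mu D.
Proof.
move=> mD c0 fc; rewrite -integral_cst//; apply: ge0_le_integral => //.
exact: measurable_funTS.
Qed.

Lemma superlevel_le_integral (a : R) : (0 <= a)%R ->
  a%:E * mu [set y | a%:E < f y] <= \int[mu]_y f y.
Proof.
move=> a0; have mV := measurable_superlevel a%:E.
apply: le_trans (integral_ge_cst mV _ _) _ => // [y /= /ltW//|].
exact: ge0_subset_integral.
Qed.

Lemma ge0_integral_setID (D E : set T) : measurable D -> measurable E ->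
  \int[mu]_(y in D) f y =
  \int[mu]_(y in D `&` E) f y + \int[mu]_(y in D `\` E) f y.
Proof.
move=> mD mE; rewrite -[in LHS](setUIDK D E) ge0_integral_setU//.
- exact: measurableI.
- exact: measurableD.
- exact: measurable_funTS.
- by apply/disj_setPS => y [[_ Ey] []].
Qed.

Lemma integral_le_superlevel (q M : R) : (0 <= q)%R -> (0 <= M)%R ->
  \int[mu]_y f y <= q%:E * mu setT + M%:E * mu [set y | q%:E < f y] +
    \int[mu]_(y in [set y | M%:E < f y]) f y.
Proof.
move=> q0 M0; set Vq := [set y | q%:E < _]; set VM := [set y | M%:E < _].
have mq : measurable Vq by exact: measurable_superlevel.
have mM : measurable VM by exact: measurable_superlevel.
have mCM := measurableC mM.
rewrite (ge0_integral_setID measurableT mM) setTI setTD addeC leeD2r//.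
rewrite (ge0_integral_setID mCM mq) addeC; apply: leeD.
- apply: (@le_trans _ _ (q%:E * mu (~` VM `\` Vq))).
    apply: integral_le_cst => // [|y [_ /negP]]; first exact: measurableD.
    by rewrite -leNgt.
  apply: lee_wpmul2l => //.
  by apply: le_measure; rewrite ?inE//; exact: measurableD.
- apply: (@le_trans _ _ (M%:E * mu (~` VM `&` Vq))).
    apply: integral_le_cst => // [|y [/negP]]; first exact: measurableI.
    by rewrite -leNgt.
  apply: lee_wpmul2l => //.
  by apply: le_measure; rewrite ?inE//; exact: measurableI.
Qed.

(* Layer-cake bound: on [a i < f <= a i.+1] the function is at most [a i.+1]. *)
Lemma superlevel_le_indic_series (a : nat -> R) y : (forall i, 0 <= a i)%R ->
  (forall r, exists i, r <= a i)%R -> (a 0%N)%:E < f y ->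
  f y <=
  \sum_(0 <= i <oo) (a i.+1)%:E * (\1_[set z | (a i)%:E < f z]%E y)%:E.
Proof.
move=> a0 a_unbounded y0; set S := \sum_(0 <= i <oo) _.
rewrite leNgt; apply/negP => S_lt.
have S_ge i : (a i)%:E < f y -> (a i.+1)%:E <= S.
  move=> yi; apply: le_trans (nneseries_ge_term i _) => [|n].
    by rewrite indicE mem_set// mule1.
  by rewrite mule_ge0 ?lee_fin.
have y_gt i : (a i)%:E < f y by elim: i => [//|i /S_ge /le_lt_trans]; exact.
move: S_lt; apply/negP; rewrite -leNgt.
suff -> : S = +oo by exact: leey.
apply/eqyP => r _.
have [[|i]] := a_unbounded (Num.max r (a 0%N + 1))%R;
  rewrite ge_max => /andP[ra].
  by rewrite gerDl ler10.
by move=> _; apply: le_trans (S_ge i (y_gt i)); rewrite lee_fin.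
Qed.

Lemma integral_superlevel_le_series (a : nat -> R) : (forall i, 0 <= a i)%R ->
  (forall r, exists i, r <= a i)%R ->
  \int[mu]_(y in [set y | (a 0%N)%:E < f y]) f y <=
  \sum_(0 <= i <oo) (a i.+1)%:E * mu [set y | (a i)%:E < f y].
Proof.
move=> a0 a_unbounded; pose V i := [set y | (a i)%:E < f y].
have mV i : measurable (V i) by exact: measurable_superlevel.
rewrite -(integral_scaled_indic_series _ (fun i => a0 i.+1) mV).
pose S y := \sum_(0 <= i <oo) (a i.+1)%:E * (\1_(V i) y)%:E.
have S0 y : 0 <= S y.
  by apply: nneseries_ge0 => i _ _; rewrite mule_ge0 ?lee_fin.
have mS : measurable_fun setT S.
  apply: ge0_emeasurable_sum => [i y _ _|i _].
    by rewrite mule_ge0 ?lee_fin.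
  exact: measurable_scaled_indic.
apply: (@le_trans _ _ (\int[mu]_(y in V 0%N) S y)).
  apply: ge0_le_integral => //; first exact: mV.
  - exact: measurable_funTS.
  - exact: measurable_funTS.
  - by move=> y; exact: superlevel_le_indic_series.
exact: ge0_subset_integral.
Qed.

Lemma integral_superlevel_le_geometric (K : R) (b : nat) : (0 < b)%N ->
  (forall i,
    mu [set y | (2 ^+ (b * i))%:E < f y] <= (K / 2 ^+ (b.+1 * i))%:E) ->
  forall J, \int[mu]_(y in [set y | (2 ^+ (b * J))%:E < f y]) f y <=
    (K * 2 ^+ b.+1 / 2 ^+ J)%:E.
Proof.
move=> b0 muf J.
have K0 := measure_le_geometric_ge0 muf.
pose a i : R := (2 ^+ (b * (J + i)))%R.
have a0 i : (0 <= a i)%R by rewrite exprn_ge0.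
have a_unbounded r : exists i, (r <= a i)%R.
  exists (Num.bound `|r|); rewrite (le_trans (ler_norm r))//.
  rewrite (le_trans (ltW (archi_boundP (normr_ge0 r))))// /a -natrX ler_nat.
  rewrite (leq_trans (ltnW (ltn_expl _ (ltnSn 1))))// leq_exp2l//.
  by rewrite (leq_trans (leq_addl J _))// leq_pmull.
have := integral_superlevel_le_series a0 a_unbounded.
rewrite /a addn0 => /le_trans; apply.
apply: le_trans (epsilon_trick0 xpredT _); last first.
  by rewrite divr_ge0// mulr_ge0.
apply: lee_nneseries => [i _ _|i _]; first by rewrite mule_ge0// lee_fin.
apply: le_trans (lee_wpmul2l _ (muf _)) _; first by rewrite lee_fin.
rewrite -EFinM lee_fin le_eqVlt; apply/orP; left; apply/eqP.
rewrite addnS mulnS mulSn !exprD natrX !exprS.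
by field; rewrite !expf_neq0 ?pnatr_eq0.
Qed.

End superlevel_sets.

Section Lnorm.
Context {R : realType} {d : measure_display} {T : measurableType d}.
Variable mu : {measure set T -> \bar R}.
Local Open Scope ereal_scope.

Lemma markov_Lnorm (f : T -> \bar R) (a p : R) :
  (forall y, 0 <= f y) -> measurable_fun setT f -> (0 <= a)%R -> (0 < p)%R ->
  (a `^ p)%:E * mu [set y | a%:E < f y] <= 'N[mu]_p%:E[f] `^ p.
Proof.
move=> f0 mf a0 p0; rewrite poweR_Lnorm ?gt_eqF//.
under eq_integral do rewrite gee0_abs//.
have mfp : measurable_fun setT (fun y => f y `^ p).
  exact: (measurableT_comp (measurable_poweR p)).
have mV := measurable_superlevel mf a%:E.
apply: (@le_trans _ _ (\int[mu]_(y in [set y | a%:E < f y]) f y `^ p)).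
  apply: integral_ge_cst => // [|y /= /ltW ay]; rewrite ?lee_fin ?powR_ge0//.
  rewrite -poweR_EFin; apply: gt0_ler_poweR => //; first exact: ltW.
    by rewrite in_itv /= leey lee_fin a0.
  by rewrite in_itv /= leey f0.
by apply: ge0_subset_integral => // y _; exact: poweR_ge0.
Qed.

End Lnorm.

Section sup_level.
Context {R : realType} {T : Type}.
Local Open Scope ereal_scope.

Definition sup_level (G : nat -> set T) (y : T) : \bar R :=
  ereal_sup (range (fun k => (k.+1%:R * \1_(G k) y)%:E)).

Lemma sup_level_pinfty G y : (forall k, G k y) -> sup_level G y = +oo.
Proof.
move=> Gy; apply/eqyP => r r0.
apply: (@le_trans _ _ ((Num.bound r).+1%:R%:E)).
  by rewrite lee_fin ltW// (lt_trans (archi_boundP (ltW r0)))// ltr_nat.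
apply: ereal_sup_ubound; exists (Num.bound r) => //.
by rewrite indicE mem_set ?mulr1.
Qed.

Lemma sup_level_ge0 G y : 0 <= sup_level G y.
Proof.
apply: (@le_trans _ _ ((1 * \1_(G 0%N) y)%:E)); first by rewrite lee_fin mul1r.
by apply: ereal_sup_ubound; exists 0%N.
Qed.

End sup_level.

Section sup_level_Lnorm.
Context {R : realType} {d : measure_display} {T : measurableType d}.
Variable mu : {measure set T -> \bar R}.
Local Open Scope ereal_scope.

Lemma integral_poweR_sup_level_le G (p : R) : (0 < p)%R ->
  (forall k, measurable (G k)) ->
  measurable_fun setT (sup_level G : T -> \bar R) ->
  \int[mu]_y (sup_level G y `^ p) <=
  \sum_(0 <= k <oo) (k.+1%:R `^ p)%:E * mu (G k).
Proof.
move=> p0 mG mS.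
have powE k y : (k.+1%:R * \1_(G k) y)%:E `^ p =
    (k.+1%:R `^ p)%:E * (\1_(G k) y)%:E :> \bar R.
  rewrite poweR_EFin indicE; case: (y \in G k).
    by rewrite mulr1 mule1.
  by rewrite mulr0 powR0 ?gt_eqF// mule0.
rewrite -integral_scaled_indic_series//.
apply: ge0_le_integral => //.
- by move=> y _; exact: poweR_ge0.
- exact: (measurableT_comp (measurable_poweR p)).
- apply: ge0_emeasurable_sum => [k y _ _|k _].
    by rewrite mule_ge0 ?lee_fin ?powR_ge0.
  exact: measurable_scaled_indic.
- move=> y _; under eq_eseriesr do rewrite -powE.
  exact: poweR_ereal_sup_le.
Qed.

Lemma Lnorm_sup_level_lty G (C p : R) (P : nat) : (0 < p)%R -> (p <= P%:R)%R ->
  (forall k, measurable (G k)) ->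
  measurable_fun setT (sup_level G : T -> \bar R) ->
  (forall k, mu (G k) <= (C / 4 ^+ (P * k))%:E) ->
  'N[mu]_p%:E[sup_level G] < +oo.
Proof.
move=> p0 pP mG mS muG; rewrite unlock; apply: poweR_lty.
under eq_integral do rewrite gee0_abs ?sup_level_ge0//.
apply: le_lt_trans (integral_poweR_sup_level_le p0 mG mS) _.
have C0 := measure_le_geometric_ge0 muG.
apply: (@le_lt_trans _ _ (2 * C)%:E); last exact: ltry.
apply: le_trans (epsilon_trick0 xpredT _); last by rewrite mulr_ge0.
have kp0 k : 0 <= (k.+1%:R `^ p)%:E by rewrite lee_fin powR_ge0.
apply: lee_nneseries => [k _ _|k _]; first by rewrite mule_ge0.
apply: le_trans (lee_wpmul2l (kp0 k) (muG k)) _.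
have P0 : (0 < P)%N by rewrite -(@ltr0n R) (lt_le_trans p0).
have kP : (k.+1%:R ^+ P * 2 ^+ k <= 4 ^+ (P * k) :> R)%R.
  rewrite -!natrX -natrM ler_nat (_ : 4 = 2 * 2)%N// expnMn leq_mul//.
    by rewrite [(P * k)%N]mulnC expnM leq_exp2r// ltn_expl.
  by rewrite leq_exp2l// leq_pmull.
rewrite -EFinM lee_fin natrX exprS -mulf_div divff// mul1r.
apply: (@le_trans _ _ (k.+1%:R ^+ P * (C / 4 ^+ (P * k))))%R.
  rewrite ler_wpM2r ?divr_ge0 ?exprn_ge0//.
  by rewrite -powR_mulrn// ler_powR// ler1n.
rewrite mulrCA ler_wpM2l// ler_pdivrMr ?exprn_gt0//.
by rewrite ler_pdivlMl ?exprn_gt0// mulrC.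
Qed.

End sup_level_Lnorm.

Section doob_maximal_inequality.
Context {R : realType} {d : measure_display} {T : measurableType d}.
Variables (mu : {measure set T -> \bar R}) (F : nat -> set (set T)).
Hypotheses (F_sigma : forall n, sigma_algebra setT (F n))
           (F_mono : forall m n, (m <= n)%N -> F m `<=` F n).
Local Open Scope ereal_scope.

Lemma sigma_algebra_seqDU (E : nat -> set T) n :
  (forall m, F m (E m)) -> F n (seqDU E n).
Proof.
move=> FE; have FnE := sigma_algebra_id (F_sigma n).
have FE_n m : (m <= n)%N -> (<<s F n>> : set (set T)) (E m).
  by move=> mn; rewrite FnE; exact: F_mono mn _ (FE m).
rewrite -FnE; apply: (@measurableD _ (g_sigma_algebraType (F n))).
  exact: FE_n.
apply: (@bigsetU_measurable _ (g_sigma_algebraType (F n))) => m _.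
by apply: FE_n; exact/ltnW/ltn_ord.
Qed.

(* The event is split according to the first index at which the threshold is
   exceeded. *)
Lemma doob_maximal_inequality (f : T -> \bar R) (g : nat -> T -> \bar R)
    (a : R) :
  (forall y, 0 <= f y) -> measurable_fun setT f ->
  (forall n, measurable_fun setT (g n)) ->
  (forall n, F n [set y | a%:E < g n y]) ->
  (forall n A, F n A -> \int[mu]_(y in A) g n y = \int[mu]_(y in A) f y) ->
  (0 <= a)%R ->
  a%:E * mu (\bigcup_n [set y | a%:E < g n y]) <= \int[mu]_y f y.
Proof.
move=> f0 mf mg Fg intg a0; pose E n := [set y | a%:E < g n y].
have mE n : measurable (E n) by exact: measurable_superlevel.
have mD n : measurable (seqDU E n).
  by apply: measurableD => //; exact: bigsetU_measurable.
have mU : measurable (\bigcup_n seqDU E n) by exact: bigcupT_measurable.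
rewrite (seqDU_bigcup_eq E) measure_semi_bigcup//.
rewrite -nneseriesZl//.
apply: (@le_trans _ _ (\sum_(0 <= n <oo) \int[mu]_(y in seqDU E n) f y)).
  apply: lee_nneseries => [n _ _|n _]; first by rewrite mule_ge0.
  rewrite -(intg n _ (sigma_algebra_seqDU n Fg)).
  by apply: integral_ge_cst => // y [/ltW].
rewrite -ge0_integral_bigcup//.
- exact: ge0_subset_integral.
- exact: measurable_funTS.
Qed.

End doob_maximal_inequality.

(** * Convergence of integrals to a point evaluation *)

Section convergence_to_dirac.
Context {R : realType} {d : measure_display} {T : measurableType d}.

(* For nonnegative [f]. *)
Definition unif_integrable (mu : nat -> {measure set T -> \bar R})
    (f : T -> \bar R) : Prop :=
  forall e : R, 0 < e -> exists2 M : R, 0 < M &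
    forall n, (\int[mu n]_(y in [set y | M%:E < f y]) f y <= e%:E)%E.

Variables (mu : nat -> {measure set T -> \bar R}) (x : T) (f : T -> \bar R).
Hypotheses (mf : measurable_fun setT f) (f_ge0 : forall y, (0 <= f y)%E).
Local Open Scope ereal_scope.
Hypothesis cvg_superlevel : forall q : rat,
  mu n [set y | (ratr q)%:E < f y] @[n --> \oo] -->
  \d_x [set y | (ratr q)%:E < f y].

Lemma near_integral_gt (r : R) : r%:E < f x ->
  \forall n \near \oo, r%:E < \int[mu n]_y f y.
Proof.
have [r0 _|r0 /rat_between_ereal[q rq qx]] := (ltP r 0)%R.
  apply: nearW => n; apply: (@lt_le_trans _ _ 0); first by rewrite lte_fin.
  exact: integral_ge0.
have q0 : (0 < ratr q :> R)%R by exact: le_lt_trans rq.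
have rq1 : (r / ratr q)%:E < 1 by rewrite lte_fin ltr_pdivrMr// mul1r.
have := @cvg_superlevel q; rewrite diracE mem_set// => /ereal_cvg_gt/(_ rq1).
apply: filterS => n q_n.
apply: lt_le_trans (superlevel_le_integral (mu n) mf f_ge0 (ltW q0)).
by rewrite -lte_pdivrMl// -EFinM mulrC.
Qed.

Hypothesis mu_setT : forall n, mu n setT = 1.
Hypothesis f_unif_integrable : unif_integrable mu f.

Lemma fin_num_unif_integrable : f x \is a fin_num.
Proof.
rewrite ge0_fin_numE// ltNge leye_eq; apply/negP => /eqP fx.
have [M M0 fM] := f_unif_integrable ltr01.
have : (M + M + 1)%:E < f x by rewrite fx ltry.
move=> /near_integral_gt[N _ /(_ N (leqnn N))] /=; apply/negP; rewrite -leNgt.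
have mV := measurable_superlevel mf M%:E.
apply: le_trans (integral_le_superlevel (mu N) mf f_ge0 (ltW M0) (ltW M0)) _.
rewrite !EFinD; apply: leeD => //; apply: leeD; first by rewrite mu_setT mule1.
rewrite -[leRHS]mule1 lee_pmul2l// -(mu_setT N).
by apply: le_measure; rewrite ?inE.
Qed.

Lemma near_integral_lt (r : R) : f x < r%:E ->
  \forall n \near \oo, \int[mu n]_y f y < r%:E.
Proof.
move=> fx_r; have fx_fin := fin_num_unif_integrable.
have [q fx_q qr] : exists2 q : rat, f x <= (ratr q)%:E & (ratr q < r)%R.
  move: fx_r; rewrite -(fineK fx_fin) lte_fin => /rat_in_itvoo[q].
  by rewrite in_itv => /andP[/ltW fx_q qr]; exists q.
have q0 : (0 <= ratr q :> R)%R by rewrite -lee_fin (le_trans (f_ge0 x)).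
pose e : R := ((r - ratr q) / 2)%R.
have e0 : (0 < e)%R by rewrite divr_gt0// subr_gt0.
have rE : r%:E = (ratr q)%:E + e%:E + e%:E.
  by rewrite -!EFinD /e; congr EFin; field.
have [M M0 fM] := f_unif_integrable e0.
have eM0 : 0 < (e / M)%:E by rewrite lte_fin divr_gt0.
have := @cvg_superlevel q; rewrite diracE memNset; last first.
  by apply/negP; rewrite -leNgt.
move=> /ereal_cvg_lt/(_ eM0); apply: filterS => n mu_q.
apply: le_lt_trans (integral_le_superlevel (mu n) mf f_ge0 q0 (ltW M0)) _.
apply: le_lt_trans (leeD2l _ (fM n)) _.
rewrite mu_setT mule1 rE lteD2rE// lteD2lE// -lte_pdivlMl// -EFinM mulrC.
exact: mu_q.
Qed.

Lemma cvg_integral_unif_integrable : \int[mu n]_y f y @[n --> \oo] --> f x.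
Proof.
have fx_fin := fin_num_unif_integrable.
rewrite -(fineK fx_fin); apply: cvg_EFin_lt => r.
  by rewrite -lte_fin fineK//; exact: near_integral_gt.
by rewrite -lte_fin fineK//; exact: near_integral_lt.
Qed.

End convergence_to_dirac.

(** * Martin-Löf tests *)

Section lower_semicomputable.
Context {R : realType} {X : completeMetricType R}.
Variable s : nat -> X.

Lemma unif_ce_open_superlevel (f : X -> \bar R) h :
  lower_semicomputable s f -> computable h ->
  unif_ce_open s (fun i => [set y | (ratr (rat_num (h i)))%:E < f y]%E).
Proof. by move=> [_ uf] ch; exact: unif_ce_open_comp uf ch. Qed.

Lemma unif_ce_open_superlevel_expn (f : X -> \bar R) (b : nat) :
  lower_semicomputable s f ->
  unif_ce_open s (fun i => [set y | (2 ^+ (b * i))%:E < f y]%E).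
Proof.
move=> lf; pose code i := rat_code (2 ^ (b * i)) 0 0.
have -> : (fun i => [set y | (2 ^+ (b * i))%:E < f y]%E) =
    (fun i => [set y | (ratr (rat_num (code i)))%:E < f y]%E).
  by apply/funext => i; rewrite ratr_code subr0 divr1 natrX.
by apply: unif_ce_open_superlevel lf _; rewrite /code; effective.
Qed.

Lemma measurable_lower_semicomputable (f : X -> \bar R) :
  lower_semicomputable s f -> measurable_fun setT (f : borel X -> \bar R).
Proof.
move=> [_ uf]; apply: (measurability _ (ErealGenOInfty.measurableE R)).
move=> _ [_ [r ->] <-]; rewrite setTI.
rewrite (_ : _ @^-1` _ = \bigcup_(q in [set q | r <= ratr (rat_num q)])
    ([set y | (ratr (rat_num q))%:E < f y]%E : set (borel X))).
  by apply: bigcup_measurable => q _; exact: measurable_unif_ce_open uf.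
rewrite preimage_itvoy; apply/seteqP; split=> y /=.
  move=> /rat_between_ereal[q rq qy]; have [k kq] := rat_num_surj q.
  by exists k; rewrite /= kq// ltW.
by move=> [q rq]; apply: le_lt_trans; rewrite lee_fin.
Qed.

Lemma unif_lower_semicomputable_nth (f : nat -> X -> \bar R) i :
  unif_lower_semicomputable s f -> lower_semicomputable s (f i).
Proof.
move=> [f_gt uf]; split=> //.
have cq : computable (fun q => npair i q) by effective.
by have := unif_ce_open_comp uf cq; under eq_fun do rewrite !npairE.
Qed.

Lemma lower_semicomputable_ereal_sup (f : nat -> X -> \bar R) :
  unif_lower_semicomputable s f ->
  lower_semicomputable s (fun y => ereal_sup (range (f^~ y))).
Proof.
move=> [f_gt uf]; split=> [y|].
  by apply: lt_le_trans (f_gt 0%N y) _; apply: ereal_sup_ubound; exists 0%N.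
rewrite (_ : (fun q => _) = (fun q => \bigcup_i
    [set y | (ratr (rat_num q))%:E < f i y]%E)); last first.
  apply/funext => q; apply/seteqP; split=> y /=.
    by move=> /ereal_sup_gt[_ [i _ <-]]; exists i.
  by move=> [i _] /lt_le_trans; apply; apply: ereal_sup_ubound; exists i.
apply: (@unif_ce_open_bigcup _ _ _ (fun=> setT)); first by effective.
have cswap : computable (fun k => npair (nsnd k) (nfst k)) by effective.
by have := unif_ce_open_comp uf cswap; under eq_fun do rewrite !npairE.
Qed.

Hypothesis s_dense : dense (range s).

Lemma unif_lower_semicomputable_scaled_indic (c : nat -> nat)
    (U : nat -> set X) :
  computable c -> unif_ce_open s U ->
  unif_lower_semicomputable s (fun i y => ((c i)%:R * \1_(U i) y)%:E).
Proof.
move=> cc uU; split=> [i y|]; first exact: ltNyr.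
pose zero := rat_code 0 0 0; pose code i := rat_code (c i) 0 0.
have -> : (fun k => [set y | (ratr (rat_num (nsnd k)))%:E <
      ((c (nfst k))%:R * \1_(U (nfst k)) y : R)%:E]%E) =
    (fun k => [set y | rat_lt (nsnd k) zero \/
      (rat_lt (nsnd k) (code (nfst k)) /\ U (nfst k) y)]).
  apply/funext => k; apply: eq_set => y; apply/propext.
  rewrite !(rat_ltE R) !ratr_code !subr0 !divr1 lte_fin indicE.
  have c0 : 0 <= (c (nfst k))%:R :> R by [].
  case: (pselect (U (nfst k) y)) => Uy.
    rewrite mem_set// mulr1; split=> [|[q0|[]//]]; first by right.
    exact: lt_le_trans q0 c0.
  by rewrite memNset// mulr0; split=> [|[|[]]//]; left.
apply: unif_ce_open_or => //; first by rewrite /zero; effective.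
apply: unif_ce_open_and; first by rewrite /code; effective.
by apply: unif_ce_open_comp uU _; effective.
Qed.

Lemma lower_semicomputable_sup_level (G : nat -> set X) :
  unif_ce_open s G -> lower_semicomputable s (sup_level G).
Proof.
move=> uG; apply: lower_semicomputable_ereal_sup.
by apply: unif_lower_semicomputable_scaled_indic uG; effective.
Qed.

Lemma lower_semicomputable_indic e :
  lower_semicomputable s (fun y => (\1_(ce_open s e) y)%:E).
Proof.
have c1 : computable (fun=> 1%N) by effective.
have := unif_lower_semicomputable_scaled_indic c1 (unif_ce_open_cst s e).
by move=> /(unif_lower_semicomputable_nth 0); under eq_fun do rewrite mul1r.
Qed.

End lower_semicomputable.

Section Martin_Lof_tests.
Context {R : realType} {X : completeMetricType R}.
Variables (s : nat -> X) (nu : probability (borel X) R).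

Lemma ML_test_tail (f : X -> \bar R) (p : R) (b c : nat) :
  0 < p -> c%:R <= b%:R * p -> ML_test s nu p f ->
  exists C : R, forall i,
    (nu ([set y | (2 ^+ (b * i))%:E < f y] : set (borel X)) <=
     (C / 2 ^+ (c * i))%:E)%E.
Proof.
move=> p0 cbp [lf f0 f_lty]; have mf := measurable_lower_semicomputable lf.
have [C NC] :
    exists C : R, ('N[nu]_p%:E[f : borel X -> \bar R] `^ p = C%:E)%E.
  exists (fine ('N[nu]_p%:E[f : borel X -> \bar R] `^ p)).
  by rewrite fineK// ge0_fin_numE ?poweR_ge0 ?poweR_lty.
exists C => i.
set V := [set y | _]; set a : R := 2 ^+ (b * i) in V *.
have mV : measurable (V : set (borel X)) by exact: measurable_superlevel.
have a_c : 2 ^+ (c * i) <= a `^ p.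
  rewrite /a -!powR_mulrn// -powRrM ler_powR ?ler1n// !natrM -mulrA.
  by rewrite [i%:R * p]mulrC mulrA ler_wpM2r.
have a0 : 0 <= a by rewrite exprn_ge0.
have : ((a `^ p)%:E * nu V <= C%:E)%E by rewrite -NC; exact: markov_Lnorm.
rewrite -(fineK (fin_num_measure nu _ mV)) -EFinM !lee_fin.
rewrite ler_pdivlMr ?exprn_gt0// mulrC; apply: le_trans.
by rewrite ler_wpM2l// fine_ge0.
Qed.

Hypothesis s_dense : dense (range s).

Lemma ML_test_sup_level (G : nat -> set X) (C p : R) (P : nat) :
  unif_ce_open s G -> 0 < p -> p <= P%:R ->
  (forall k, nu (G k : set (borel X)) <= (C / 4 ^+ (P * k))%:E)%E ->
  ML_test s nu p (sup_level G).
Proof.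
move=> uG p0 pP nuG; have lG := lower_semicomputable_sup_level s_dense uG.
split=> // [y|]; first exact: sup_level_ge0.
apply: Lnorm_sup_level_lty nuG => // [k|].
  exact: measurable_unif_ce_open uG.
exact: measurable_lower_semicomputable lG.
Qed.

Lemma ML_test_indic (p : R) e : 0 < p ->
  ML_test s nu p (fun y => (\1_(ce_open s e) y)%:E).
Proof.
move=> p0; split; first exact: lower_semicomputable_indic.
  by move=> y; rewrite lee_fin.
rewrite unlock; apply: poweR_lty.
rewrite (eq_integral (fun y => (\1_(ce_open s e : set (borel X)) y)%:E)).
  have mU := measurable_ce_open s e.
  rewrite integral_indic ?setIT//.
  by rewrite (le_lt_trans (probability_le1 nu mU)) ?ltry.
move=> y _; rewrite indicE; case: (y \in _); rewrite /= ?normr1 ?normr0.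
  by rewrite powR1.
by rewrite powR0 ?gt_eqF.
Qed.

Lemma MLR_exists_notin (G : nat -> set X) (C : R) x : unif_ce_open s G ->
  (forall k, nu (G k : set (borel X)) <= (C / 4 ^+ k)%:E)%E ->
  MLR s nu x -> exists k, ~ G k x.
Proof.
move=> uG nuG xM; apply/existsNP => xG.
suff /xM : ML_test s nu 1 (sup_level G) by rewrite sup_level_pinfty// ltxx.
by apply: (@ML_test_sup_level G C 1 1) => // k; rewrite mul1n.
Qed.

End Martin_Lof_tests.

Section Kurtz_random.
Context {R : realType} {X : completeMetricType R}.
Variables (s : nat -> X) (nu : probability (borel X) R).
Hypotheses (s_polish : computable_polish s)
           (nu_computable : computable_measure s nu).

Lemma sigma1_lt_measure (U : nat -> set X) : unif_ce_open s U ->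
  sigma1 [set k |
    (ratr (rat_num (nfst k)))%:E < nu (U (nsnd k) : set (borel X))]%E.
Proof.
move=> /unif_ce_open_index[e ce UE]; move/ce_sigma1: nu_computable => snu.
have cswap : computable (fun k => npair (e (nsnd k)) (nfst k)) by effective.
by apply: eq_sigma1 (sigma1_comp snu cswap) => k; rewrite /= !npairE UE.
Qed.

(* In the notation of [ce_open_exhaustion], the [k]-th cover is the union of the
   [W n] such that [U n] is known to have measure above [1 - 4 ^- k]. *)
Lemma null_complement_cover e : nu (ce_open s e : set (borel X)) = 1%E ->
  exists2 G, unif_ce_open s G & forall k, ~` ce_open s e `<=` G k /\
    (nu (G k : set (borel X)) <= (1 / 4 ^+ k)%:E)%E.
Proof.
move=> nu_e; have [U [W [uU uW U_mono UE UW]]] := ce_open_exhaustion s_polish e.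
have mU n : measurable (U n : set (borel X)).
  exact: measurable_unif_ce_open uU.
pose code k := rat_code (4 ^ k) 1 (4 ^ k).-1.
have codeE k : ratr (rat_num (code k)) = 1 - 1 / 4 ^+ k :> R.
  by rewrite ratr_code_pred ?expn_gt0// natrX mulrBl divff.
pose exceeds q n := ((ratr (rat_num q))%:E < nu (U n : set (borel X)))%E.
pose G k := \bigcup_(n in [set n | exceeds (code k) n]) W n.
have uG : unif_ce_open s G.
  apply: (@unif_ce_open_bigcup _ _ _ _ (fun _ n => W n)).
    have sU := sigma1_lt_measure uU.
    apply: (@sigma1_comp2 exceeds (code \o nfst)) sU _ _.
      by rewrite /code /comp; effective.
    by effective.
  by apply: unif_ce_open_comp uW _; effective.
have exceeds_ex k : exists n, exceeds (code k) n.
  have : nu (U n : set (borel X)) @[n --> \oo] --> nu (ce_open s e).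
    rewrite -UE; apply: nondecreasing_cvg_mu => //.
    by rewrite UE; exact: measurable_ce_open.
  have code1 : ((ratr (rat_num (code k)))%:E < 1%:E :> \bar R)%E.
    by rewrite codeE lte_fin ltrBlDr ltrDl divr_gt0 ?exprn_gt0.
  rewrite nu_e => /ereal_cvg_gt/(_ code1)[n _ /(_ n (leqnn n)) n_exceeds].
  by exists n.
exists G => // k; have [n n_exceeds n_min] := ex_minnP (exceeds_ex k).
split=> [y ye|]; first by exists n => //; apply: contrapT => /(UW n).2.
have Gn : G k `<=` ~` U n.
  by move=> y [m /n_min/U_mono/subsetPset nm /[swap] /nm /(UW m).1].
apply: (@le_trans _ _ (nu (~` (U n : set (borel X))))).
  apply: le_measure => //; rewrite inE; first exact: measurable_unif_ce_open uG.
  exact: measurableC.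
rewrite probability_setC//; move: n_exceeds; rewrite /exceeds codeE.
rewrite -(fineK (fin_num_measure nu _ (mU n))) -EFinB !lte_fin lee_fin.
by lra.
Qed.

Lemma MLR_KR : MLR s nu `<=` KR s nu.
Proof.
move=> x xM e /null_complement_cover[G uG GP]; apply: contrapT => xe.
have [k] := MLR_exists_notin s_polish.1 uG (fun k => (GP k).2) xM.
by apply; exact: (GP k).1.
Qed.

End Kurtz_random.

(** * Disintegrations and density random points *)

Section disintegrations.
Context {R : realType} {X : completeMetricType R}.
Variables (s : nat -> X) (nu : probability (borel X) R).
Variable F : nat -> set (set X).
Variable rho : nat -> R.-ftker (borel X) ~> (borel X).

Lemma cond_exp_indic (k : R.-ftker (borel X) ~> (borel X)) (U : set X) x :
  measurable (U : set (borel X)) ->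
  cond_exp k (fun y => (\1_U y)%:E) x = k x U.
Proof. by move=> mU; rewrite /cond_exp integral_indic// setIT. Qed.

Definition dirac_limit (x : X) : Prop := forall e,
  rho n x (ce_open s e) @[n --> \oo] --> \d_(x : borel X) (ce_open s e).

Lemma dirac_limit_superlevel (f : X -> \bar R) x :
  lower_semicomputable s f -> dirac_limit x -> forall q : rat,
  rho n x [set y | (ratr q)%:E < f y]%E @[n --> \oo] -->
    \d_(x : borel X) [set y | (ratr q)%:E < f y]%E.
Proof.
move=> [_ /unif_ce_open_index[e _ fE]] x_lim q; have [k <-] := rat_num_surj q.
by rewrite fE; exact: x_lim.
Qed.

Hypotheses (F_filtration : almost_full_filtration s nu F)
           (rho_disintegration : kurtz_disintegrations s nu F rho).

Lemma filtration_sigma_algebra n : sigma_algebra setT (F n).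
Proof.
by have [_ [A [-> _ _]]] := F_filtration; exact: smallest_sigma_algebra.
Qed.

Lemma filtration_mono m n : (m <= n)%N -> F m `<=` F n.
Proof.
have [FS _] := F_filtration.
move=> /subnK <-; elim: (n - m)%N => [//|k IH].
exact: subset_trans IH (FS _).
Qed.

Local Open Scope ereal_scope.

Lemma disintegration_maximal_inequality (V : set X) (a : R) :
  measurable (V : set (borel X)) -> (0 <= a)%R ->
  a%:E * nu (\bigcup_n [set y : borel X | a%:E < rho n y V]) <=
  nu (V : set (borel X)).
Proof.
move=> mV a0; have [rho_version _ _] := rho_disintegration.
have iV : nu.-integrable [set: borel X] (fun y => (\1_V y)%:E).
  exact: integrable_indic.
have rhoV n : cond_exp (rho n) (fun y => (\1_V y)%:E) = fun y => rho n y V.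
  by apply/funext => y; rewrite cond_exp_indic.
have -> : nu V = \int[nu]_y (\1_V (y : borel X))%:E.
  by rewrite integral_indic ?setIT.
apply: (@doob_maximal_inequality _ _ (borel X) nu F filtration_sigma_algebra
  filtration_mono _ (fun n y => rho n y V)) => //.
- exact/measurable_EFinP/measurable_indic.
- by move=> n; exact: measurable_kernel.
- move=> n; have [+ _ _] := rho_version n _ iV; rewrite rhoV.
  move=> /(emeasurable_fun_o_infty measurableT)/(_ a%:E); rewrite setTI.
  by rewrite /measurable /= sigma_algebra_id//; exact: filtration_sigma_algebra.
- by move=> n A FA; have [_ _ /(_ A FA)] := rho_version n _ iV; rewrite rhoV.
Qed.

Lemma measure_bigcup_disintegration_gt_le (V : nat -> set X) (C t : R)
    (c : nat) :
  (0 < t)%R ->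
  (forall i, measurable (V i : set (borel X))) ->
  (forall i, nu (V i : set (borel X)) <= (C / 2 ^+ (c.+1 * i))%:E) ->
  nu (\bigcup_i \bigcup_n
    [set y : borel X | (t / 2 ^+ (c * i))%:E < rho n y (V i)]) <=
  (2 * C / t)%:E.
Proof.
move=> t0 mV nuV; pose E i := \bigcup_n
  [set y : borel X | (t / 2 ^+ (c * i))%:E < rho n y (V i)].
have mE i : measurable (E i).
  apply: bigcupT_measurable => n.
  by apply: measurable_superlevel; exact: measurable_kernel.
have C0 := measure_le_geometric_ge0 nuV.
apply: le_trans (measure_sigma_subadditive nu mE _ (fun y => id)) _.
  exact: bigcupT_measurable.
apply: le_trans (epsilon_trick0 xpredT _); last first.
  by rewrite divr_ge0 ?mulr_ge0 ?(ltW t0).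
apply: lee_nneseries => // i _.
have a0 : (0 < t / 2 ^+ (c * i) :> R)%R by rewrite divr_gt0 ?exprn_gt0.
have := le_trans (disintegration_maximal_inequality (mV i) (ltW a0)) (nuV i).
rewrite -lee_pdivlMl// -EFinM => /le_trans; apply.
rewrite lee_fin le_eqVlt; apply/orP; left; apply/eqP.
rewrite mulSn exprD natrX exprS; field.
by rewrite !expf_neq0 ?pnatr_eq0//= gt_eqF.
Qed.

Hypothesis s_dense : dense (range s).

Lemma MLR_disintegration_le_geometric (V : nat -> set X) (C : R) (c : nat) x :
  unif_ce_open s V ->
  (forall i, nu (V i : set (borel X)) <= (C / 2 ^+ (c.+1 * i))%:E) ->
  MLR s nu x ->
  exists k, forall n i, rho n x (V i) <= (4 ^+ k / 2 ^+ (c * i))%:E.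
Proof.
move=> uV nuV xM; have [_ _ [_ urho]] := rho_disintegration.
have mV i : measurable (V i : set (borel X)).
  exact: measurable_unif_ce_open uV.
have [e ce VE] := unif_ce_open_index uV.
pose code k i := rat_code (4 ^ k) 0 (2 ^ (c * i)).-1.
have codeE k i : ratr (rat_num (code k i)) = (4 ^+ k / 2 ^+ (c * i))%R :> R.
  by rewrite ratr_code_pred ?expn_gt0// subr0 !natrX.
pose E k i n := [set y | (4 ^+ k / 2 ^+ (c * i))%:E < rho n y (V i)].
pose G k := \bigcup_i \bigcup_n E k i n.
have uG : unif_ce_open s G.
  apply: (@unif_ce_open_bigcup _ _ _ (fun=> setT)); first by effective.
  apply: (@unif_ce_open_bigcup _ _ _ (fun=> setT)
    (fun l n => E (nfst l) (nsnd l) n)); first by effective.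
  have -> : (fun l => E (nfst (nfst l)) (nsnd (nfst l)) (nsnd l)) = (fun l =>
      [set y | (ratr (rat_num (code (nfst (nfst l)) (nsnd (nfst l)))))%:E <
        rho (nsnd l) y (ce_open s (e (nsnd (nfst l))))]).
    by apply/funext => l; rewrite /E codeE VE.
  have ccode : computable (fun l => npair (npair (nsnd l) (e (nsnd (nfst l))))
      (code (nfst (nfst l)) (nsnd (nfst l)))) by rewrite /code; effective.
  by have := unif_ce_open_comp urho ccode; under eq_fun do rewrite !npairE.
have nuG k : nu (G k : set (borel X)) <= (2 * C / 4 ^+ k)%:E.
  by apply: measure_bigcup_disintegration_gt_le => //; rewrite exprn_gt0.
have [k xk] := MLR_exists_notin s_dense uG nuG xM.
exists k => n i; rewrite leNgt; apply/negP => gt_n; apply: xk.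
by exists i => //; exists n.
Qed.

Lemma MLR_unif_integrable (f : X -> \bar R) (p : R) x :
  (1 < p)%R -> ML_test s nu p f -> MLR s nu x ->
  unif_integrable (fun n => rho n x) (f : borel X -> \bar R).
Proof.
move=> p1 fp xM e e0; have [lf f0 _] := fp.
have mf := measurable_lower_semicomputable lf.
pose b := Num.bound (2 / (p - 1)).
have bp : (b.+2%:R <= b%:R * p)%R.
  have : (2 / (p - 1) < b%:R)%R.
    by rewrite archi_boundP// divr_ge0// subr_ge0 ltW.
  by rewrite ltr_pdivrMr ?subr_gt0// -addn2 natrD; lra.
have b0 : (0 < b)%N.
  by rewrite lt0n; apply/eqP => b_0; move: bp; rewrite b_0 mul0r lern0.
have [C nuC] := ML_test_tail (lt_trans ltr01 p1) bp fp.
have [k rho_k] := MLR_disintegration_le_geometric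
  (unif_ce_open_superlevel_expn b lf) nuC xM.
pose K : R := (4 ^+ k * 2 ^+ b.+1)%R.
have K0 : (0 < K)%R by rewrite mulr_gt0 ?exprn_gt0.
have eK : (0 < e / K)%R by rewrite divr_gt0.
have [J _ /(_ J (leqnn J))/= J_e] := near_infty_natSinv_expn_lt (PosNum eK).
exists (2 ^+ (b * J))%R => [|n]; first by rewrite exprn_gt0.
apply: le_trans (integral_superlevel_le_geometric mf f0 b0 (rho_k n) J) _.
by move: J_e; rewrite div1r ltr_pdivlMr// mulrC lee_fin => /ltW.
Qed.

End disintegrations.

Section density_random.
Context {R : realType} {X : completeMetricType R}.
Variables (s : nat -> X) (nu : probability (borel X) R).
Variable F : nat -> set (set X).
Variable rho : nat -> R.-ftker (borel X) ~> (borel X).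
Hypothesis s_polish : computable_polish s.

Lemma MLR_of_cond_exp_cvg (p : R) x : 0 < p ->
  (forall f, ML_test s nu p f ->
     exists l : R, cond_exp (rho n) f x @[n --> \oo] --> l%:E) ->
  dirac_limit s rho x -> MLR s nu x.
Proof.
move=> p0 x_cvg x_lim f f1; rewrite ltNge leye_eq; apply/negP => /eqP fx.
have [lf _ _] := f1.
pose P := Num.bound p.
have pP : p <= P%:R by rewrite ltW// archi_boundP// ltW.
have [|C nuC] := @ML_test_tail _ _ s nu f 1 (2 * P) (2 * P) ltr01 _ f1.
  by rewrite mulr1.
have uG := unif_ce_open_superlevel_expn (2 * P) lf; set G := fun i => _ in uG.
have gp : ML_test s nu p (sup_level G).
  apply: (ML_test_sup_level s_polish.1 (C := C) uG p0 pP) => k.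
  apply: le_trans (nuC k) _; rewrite -mulnA exprM (_ : 2 ^+ 2 = 4)//.
  by rewrite expr2 -natrM.
have [l g_l] := x_cvg _ gp; have [lg g0 _] := gp.
have gx : ((l + 1)%:E < sup_level G x)%E.
  by rewrite sup_level_pinfty ?ltry// => k; rewrite /G /= fx ltry.
have mg := measurable_lower_semicomputable lg.
have g_gt := near_integral_gt mg g0 (dirac_limit_superlevel lg x_lim) gx.
have g_lt : \forall n \near \oo,
    (cond_exp (rho n) (sup_level G) x < (l + 1)%:E)%E.
  by apply: ereal_cvg_lt g_l _; rewrite lte_fin ltrDl.
have [n _ /(_ n (leqnn n))/= []] := filterI g_gt g_lt.
by move=> /lt_trans /[apply]; rewrite ltxx.
Qed.

Hypotheses (nu_computable : computable_measure s nu)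
           (F_filtration : almost_full_filtration s nu F)
           (rho_disintegration : kurtz_disintegrations s nu F rho).

Lemma DR_cond_exp_cvg (f : X -> \bar R) (p : R) x : 1 < p ->
  ML_test s nu p f -> DR s nu rho x ->
  f x \is a fin_num /\ cond_exp (rho n) f x @[n --> \oo] --> f x.
Proof.
move=> p1 fp [xM x_lim]; have [lf f0 _] := fp.
have mf := measurable_lower_semicomputable lf.
have f_lim := dirac_limit_superlevel lf x_lim.
have xK := MLR_KR s_polish nu_computable xM.
have rhoT n : rho n x setT = 1%E.
  by have [_ /(_ n x xK)[]] := rho_disintegration.
have f_ui := MLR_unif_integrable F_filtration rho_disintegration
  s_polish.1 p1 fp xM.
split; first exact: (fin_num_unif_integrable mf f0 f_lim rhoT f_ui).
exact: (cvg_integral_unif_integrable mf f0 f_lim rhoT f_ui).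
Qed.

End density_random.

Theorem theorem1p8 (R : realType) (X : completeMetricType R) (s : nat -> X)
    (nu : probability (borel X) R) (F : nat -> set (set X))
    (rho : nat -> R.-ftker (borel X) ~> (borel X)) (p : R) :
  computable_polish s ->
  computable_measure s nu ->
  almost_full_filtration s nu F ->
  kurtz_disintegrations s nu F rho ->
  1 < p -> computable_real p ->
  forall x : X,
  [<-> DR s nu rho x;
       KR s nu x /\
       forall f, ML_test s nu p f ->
         f x \is a fin_num /\ cond_exp (rho n) f x @[n --> \oo] --> f x;
       [/\ KR s nu x,
           forall f, ML_test s nu p f ->
             exists l : R, cond_exp (rho n) f x @[n --> \oo] --> l%:E &
           forall e,
             cond_exp (rho n) (fun y => (\1_(ce_open s e) y)%:E) x @[n --> \oo]
               --> ((\1_(ce_open s e) x)%:E : \bar R)]].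
Proof.
move=> s_polish nu_computable F_filtration rho_disintegration p1 _ x.
have p0 : 0 < p by exact: lt_trans p1.
tfae.
- move=> xD; split; first exact: MLR_KR xD.1.
  move=> f fp.
  exact: (DR_cond_exp_cvg s_polish nu_computable F_filtration
    rho_disintegration p1 fp xD).
- move=> [xK x_cvg]; split=> // [f /x_cvg[f_fin f_cvg]|e].
    by exists (fine (f x)); rewrite fineK.
  by have [] := x_cvg _ (ML_test_indic nu s_polish.1 e p0).
- move=> [_ x_cvg x_ind].
  have x_lim : dirac_limit s rho x.
    move=> e; have := x_ind e.
    by under eq_cvg do rewrite (cond_exp_indic _ _ (measurable_ce_open s e)).
  by split=> //; exact: (MLR_of_cond_exp_cvg s_polish p0 x_cvg x_lim).
Qed.
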